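(* Let $n>2$ be an integer, and write $n=2m$ if $n$ is even and $n=2m+1$ if $n$ is odd. Let $t_0\in\mathbb{R}$ be such that $a(t)^kX_2\subset X_1$ for all $t\in\mathbb{C}$ with $|t|>t_0$ and all $k\in\mathbb{Z}$, $k\neq0$, and let $s_0=2$. Let $t\in(n-1)!\,\mathbb{Z}$ and $s\in\mathbb{Z}$ be such that $|t|>t_0$ and $|s|>s_0$, and let $H_n(t,s)=\langle a(t),b(s)\rangle$. If $n$ is odd, then $H_{2m+1}(t,s)$ is a thin subgroup of $\mathrm{SL}(2m+1,\mathbb{Z})$; if $n$ is even, then $H_{2m}(t,s)$ is a thin subgroup of $\mathrm{Sp}(2m,\mathbb{Z})$.
   Context: A subgroup of $\mathrm{SL}(n,\mathbb{Z})$ (respectively $\mathrm{Sp}(n,\mathbb{Z})$) is called thin if it is Zariski-dense in $\mathrm{SL}(n,\mathbb{C})$ (respectively $\mathrm{Sp}(n,\mathbb{C})$) and has infinite index in $\mathrm{SL}(n,\mathbb{Z})$ (respectively $\mathrm{Sp}(n,\mathbb{Z})$). $e_{i,j}$ denotes the $n\times n$ matrix with a $1$ in position $(i,j)$ and zeros elsewhere, and $1_n$ is the identity matrix. Put $x=\sum_{i=1}^{n-1}e_{i,i+1}$ and $y=e_{n,1}$. For $t,s\in\mathbb{C}$ let $a(t)=\exp(tx)=1_n+\sum_{i<j}\frac{t^{j-i}}{(j-i)!}e_{i,j}$ and $b(s)=\exp(sy)=1_n+se_{n,1}$. These act on $\mathbb{C}^n$ from the left (vectors regarded as columns). Let $X_1=\{(x_1,\ldots,x_n)\in\mathbb{C}^n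 : |x_1|>|x_i|,\ 2\le i\le n\}$ and $X_2=\{(x_1,\ldots,x_n)\in\mathbb{C}^n : |x_n|>|x_i|,\ 1\le i\le n-1\}$. For each $n$ a number $t_0$ (depending on $n$) with the property required in the claim exists. For $n=2m$ even, $\mathrm{Sp}(n,\mathbb{C})$ is realized as $\{g\in\mathrm{GL}(n,\mathbb{C}) : gJg^{T}=J\}$, where $J=\sum_{i=1}^n(-1)^ie_{i,n+1-i}$ (a nondegenerate skew-symmetric matrix), and $\mathrm{Sp}(n,\mathbb{Z})$ is the subgroup of $\mathrm{Sp}(n,\mathbb{C})$ of matrices with integer entries. *)

(* Defs.v *)
From mathcomp Require Import all_boot all_order all_algebra.
From mathcomp Require Import classical_sets cardinality reals.
From mathcomp Require Import complex.
From mathcomp.multinomials Require Import mpoly.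

Set Implicit Arguments.
Unset Strict Implicit.
Unset Printing Implicit Defensive.

Import Order.TTheory GRing.Theory Num.Theory.

Local Open Scope classical_set_scope.
Local Open Scope ring_scope.

(* The size of the matrices is written N.+1, so that 'M[K]_N.+1 is a
   unitRingType: 1, *, ^-1 and ^ (integer power) are then those of matrices,
   and the invertible elements are those of GL(N.+1, K). *)

Section Subgroups.
Variables (K : fieldType) (N : nat).
Implicit Types (S H G : set 'M[K]_N.+1).

Definition is_subgroup H : Prop :=
  [/\ H `<=` [set g | g \is a GRing.unit],
      H 1,
      forall g h, H g -> H h -> H (g * h) &
      forall g, H g -> H g^-1].

Definition generated S : set 'M[K]_N.+1 :=
  \bigcap_(H in [set H | is_subgroup H /\ S `<=` H]) H.

Definition lcoset (g : 'M[K]_N.+1) H : set 'M[K]_N.+1 := [set g * h | h in H].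

Definition lcosets H G : set (set 'M[K]_N.+1) := [set lcoset g H | g in G].

Definition infinite_index H G : Prop := infinite_set (lcosets H G).

(* Matrices are identified with the points of affine space of dimension
   N.+1 * N.+1 through mxvec. *)
Definition peval (p : {mpoly K[N.+1 * N.+1]}) (g : 'M[K]_N.+1) : K :=
  p.@[fun i => mxvec g 0 i].

Definition zariski_closed (Z : set 'M[K]_N.+1) : Prop :=
  exists I : set {mpoly K[N.+1 * N.+1]},
    Z = [set g | forall p, I p -> peval p g = 0].

Definition zariski_closure S : set 'M[K]_N.+1 :=
  \bigcap_(Z in [set Z | zariski_closed Z /\ S `<=` Z]) Z.

(* Density for the topology induced on G: the closure of H in G is all of G. *)
Definition zariski_dense H G : Prop :=
  H `<=` G /\ zariski_closure H `&` G = G.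

Definition integer_points G : set 'M[K]_N.+1 :=
  [set g | G g /\ exists B : 'M[int]_N.+1, g = map_mx intr B].

Definition thin_subgroup H G : Prop :=
  [/\ is_subgroup H,
      H `<=` integer_points G,
      zariski_dense H G &
      infinite_index H (integer_points G)].

Definition SLn : set 'M[K]_N.+1 := [set g | \det g = 1].

(* Indices start at 0 here, whence the exponent i.+1; rev_ord i is the
   0-based form of the index n + 1 - i. *)
Definition Jmx : 'M[K]_N.+1 :=
  \sum_(i < N.+1) (-1) ^+ i.+1 *: delta_mx i (rev_ord i).

Definition Spn : set 'M[K]_N.+1 :=
  [set g | g \is a GRing.unit /\ g *m Jmx *m g^T = Jmx].

End Subgroups.

Arguments SLn : clear implicits.
Arguments Spn : clear implicits.

Section PingPong.
Variables (K : numFieldType) (N : nat).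

Definition xmx : 'M[K]_N.+1 :=
  \sum_(i < N) delta_mx (inord i) (inord i.+1).

Definition ymx : 'M[K]_N.+1 := delta_mx ord_max ord0.

Definition amx (t : K) : 'M[K]_N.+1 :=
  1 + \sum_(i < N.+1) \sum_(j < N.+1 | (i < j)%N)
        (t ^+ (j - i) / (j - i)`!%:R) *: delta_mx i j.

Definition bmx (s : K) : 'M[K]_N.+1 := 1 + s *: ymx.

Definition Hgrp (t s : K) : set 'M[K]_N.+1 := generated [set amx t; bmx s].

Definition X1 : set 'cV[K]_N.+1 :=
  [set v | forall i, i != ord0 -> `|v i 0| < `|v ord0 0|].

Definition X2 : set 'cV[K]_N.+1 :=
  [set v | forall i, i != ord_max -> `|v i 0| < `|v ord_max 0|].

Lemma xmxE i j : xmx i j = (j == i.+1 :> nat)%:R.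
Proof.
rewrite /xmx summxE.
have [ji|ji] := eqVneq (j : nat) i.+1; last first.
  apply: big1 => k _; rewrite mxE; case: eqP => // ei; case: eqP => // ej.
  by case/eqP: ji; rewrite ej ei !inordK // ltnS ?(ltnW (ltn_ord k)).
have iN : (i < N)%N by rewrite -ltnS -ji.
rewrite (bigD1 (Ordinal iN)) //= big1 ?addr0 => [|k ki].
  by rewrite mxE -ji !inord_val !eqxx.
rewrite mxE; case: eqP => // ei; case/eqP: ki; apply: val_inj => /=.
by rewrite ei inordK // ltnS ltnW.
Qed.

Lemma xmx_expE k i j : (xmx ^+ k) i j = (j == (i + k)%N :> nat)%:R.
Proof.
elim: k i j => [|k IHk] i j.
  by rewrite expr0 mxE addn0 eq_sym.
rewrite exprS mxE.
have [iN|iN] := ltnP i N; last first.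
  rewrite big1 => [|l _]; last first.
    by rewrite xmxE ltn_eqF ?mul0r // (leq_trans (ltn_ord l)).
  by rewrite ltn_eqF // (leq_trans (ltn_ord j)) // addnS ltnS (leq_trans iN) ?leq_addr.
have iN' : (i.+1 < N.+1)%N by [].
rewrite (bigD1 (Ordinal iN')) //= big1 ?addr0 => [|l li].
  by rewrite xmxE eqxx mul1r IHk addSnnS.
rewrite xmxE; case: eqP => [e|_]; last by rewrite mul0r.
by case/eqP: li; apply: val_inj.
Qed.

Lemma xmx_nilp : xmx ^+ N.+1 = 0.
Proof.
apply/matrixP => i j; rewrite xmx_expE mxE ltn_eqF //.
by rewrite (leq_trans (ltn_ord j)) // leq_addl.
Qed.

(* amx t = exp (t xmx): by xmx_nilp the exponential series stops at N. *)
Lemma amx_exp t :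
  amx t = \sum_(k < N.+1) (k`!%:R)^-1 *: (t *: xmx) ^+ k.
Proof.
apply/matrixP => i j; rewrite mxE !summxE.
under [in RHS]eq_bigr do rewrite exprZn !mxE xmx_expE.
have -> : \sum_(k < N.+1) (\sum_(j0 < N.+1 | (k < j0)%N)
      (t ^+ (j0 - k) / (j0 - k)`!%:R) *: delta_mx k j0 : 'M[K]_N.+1) i j
    = if (i < j)%N then t ^+ (j - i) / (j - i)`!%:R else 0.
  rewrite (bigD1 i) //= [X in _ + X]big1 ?addr0 => [|k ki]; last first.
    rewrite summxE big1 // => l _.
    by rewrite !mxE eq_sym (negbTE ki) mulr0.
  rewrite summxE; case: ifP => ij.
    rewrite (bigD1 j) //= big1 ?addr0 => [|l /andP[_ lj]].
      by rewrite !mxE !eqxx mulr1.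
    by rewrite !mxE [j == l]eq_sym (negbTE lj) andbF mulr0.
  rewrite big1 // => l il; rewrite !mxE eqxx /=.
  by case: eqP => [e|_]; rewrite ?mulr0 //; rewrite e il in ij.
have [ij|ji] := leqP i j; last first.
  rewrite ltnNge (ltnW ji) /= addr0 mxE -(inj_eq val_inj) /= gtn_eqF //.
  by rewrite big1 // => k _; rewrite ltn_eqF ?mulr0 // ltn_addr.
have dN : (j - i < N.+1)%N by rewrite (leq_ltn_trans (leq_subr _ _)).
rewrite (bigD1 (Ordinal dN)) //= subnKC // eqxx mulr1.
rewrite [X in _ = _ + X]big1 ?addr0 => [|k kd]; last first.
  case: eqP => [e|_]; last by rewrite !mulr0.
  by case/eqP: kd; apply: val_inj; rewrite /= e addKn.
rewrite mxE -(inj_eq val_inj) /=; have [e|ne] := eqVneq (i : nat) j.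
  by rewrite e ltnn subnn fact0 expr0 invr1 mulr1 addr0.
by rewrite ltn_neqAle ne ij /= add0r mulrC.
Qed.

End PingPong.

Arguments amx {K} N t.
Arguments bmx {K} N s.
Arguments Hgrp {K} N t s.
Arguments X1 : clear implicits.
Arguments X2 : clear implicits.

(* Main.v *)
(** Let I be the ideal of the polynomials vanishing on H, and L the Lie algebra
    of the matrices X whose left-invariant derivation (D_X p)(g) = dp_g(g X)
    maps I into itself.  If X^2 = 0 and X is in L, Taylor's formula shows that
    the Zariski closure of H is stable under right multiplication by 1 + c X.
    Conversely L contains X as soon as 1 + c X is in H for infinitely many c,
    e.g. X = Y(z) = a(z) y a(-z) for z in t Z.  With c(z) the last column of
    a(z) and f(z) the first row of a(-z) one has Y(z) = c(z) f(z) and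
      [Y(z), Y(w)] = (w - z)^N / N! (c(z) f(w) - (-1)^N c(w) f(z)),  n = N + 1,
    whose coefficients in z and w are, up to scalars, the matrices
    e_{i,j} - (-1)^(i+j) e_{j',i'} with j' = n + 1 - j.  For n even they span
    sp_n; for n odd they generate sl_n together with y.  Since SL_n and Sp_n
    are generated by transvections, H is dense.

    The index is infinite because, by ping-pong, the stabilizer of e_1 in H is
    the group generated by a(t), which contains no power of 1 + e_{1,n} but 1. *)

Require Import Defs.
From mathcomp Require Import all_boot all_order all_algebra.
From mathcomp Require Import classical_sets cardinality reals.
From mathcomp Require Import complex.
From mathcomp.multinomials Require Import mpoly.
From mathcomp Require Import ring zify.

Set Implicit Arguments.
Unset Strict Implicit.
Unset Printing Implicit Defensive.

Import Order.TTheory GRing.Theory Num.Theory.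

Local Open Scope classical_set_scope.
Local Open Scope ring_scope.

(** * Subgroups and their integral points *)

Section SubgroupsOfGL.
Variables (K : fieldType) (N : nat).
Implicit Types (S G H : set 'M[K]_N.+1) (g h : 'M[K]_N.+1).

Lemma generated_min S G : is_subgroup G -> S `<=` G -> generated S `<=` G.
Proof. by move=> sG SG g; apply. Qed.

Lemma sub_generated S : S `<=` generated S.
Proof. by move=> g Sg G [_]; apply. Qed.

Lemma unit_is_subgroup : is_subgroup [set g : 'M[K]_N.+1 | g \is a GRing.unit].
Proof.
split=> //=; first exact: unitr1.
  by move=> g h gu hu; rewrite unitrMl.
by move=> g gu; rewrite unitrV.
Qed.

Lemma generated_is_subgroup S :
  S `<=` [set g | g \is a GRing.unit] -> is_subgroup (generated S).
Proof.
move=> Su; split.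
- exact: generated_min unit_is_subgroup Su.
- by move=> G [[]].
- move=> g h Hg Hh G [sG SG]; case: (sG) => _ _ GM _.
  by apply: GM; [apply: Hg | apply: Hh].
- by move=> g Hg G [sG SG]; case: (sG) => _ _ _; apply; apply: Hg.
Qed.

Lemma SLn_is_subgroup : is_subgroup (SLn K N).
Proof.
split; rewrite /SLn /=.
- by move=> g /= g1; rewrite -[_ \is a _]/(g \in unitmx) unitmxE g1 unitr1.
- exact: det1.
- by move=> g h g1 h1; rewrite [LHS]det_mulmx g1 h1 mulr1.
- by move=> g g1; rewrite [LHS]det_inv g1 invr1.
Qed.

Lemma SpnM g h : Spn K N g -> Spn K N h -> Spn K N (g *m h).
Proof.
move=> [gu gJ] [hu hJ]; split.
  by rewrite -[_ \is a _]/(g * h \is a GRing.unit) unitrMl.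
by rewrite trmx_mul !mulmxA -(mulmxA g h) -(mulmxA g (h *m _)) hJ gJ.
Qed.

Lemma Spn_is_subgroup : is_subgroup (Spn K N).
Proof.
split.
- by move=> g [].
- by split; [exact: unitr1 | rewrite trmx1 mulmx1 mul1mx].
- exact: SpnM.
- move=> g [gu gJ]; split; first by rewrite unitrV.
  have gT : (g^-1 *m g)^T = 1 by rewrite [_ *m _]mulVr // trmx1.
  rewrite -[in LHS]gJ !mulmxA [g^-1 *m g]mulVr // mul1mx -mulmxA -trmx_mul gT.
  by rewrite mulmx1.
Qed.

(** Integrality of the inverse is built in, so closure under inversion is immediate and
    [generated_min] can be applied to this set. *)
Definition integral_units G : set 'M[K]_N.+1 :=
  [set g | G g /\ exists B C : 'M[int]_N.+1,
     g = map_mx intr B /\ g^-1 = map_mx intr C].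

Lemma integral_units_is_subgroup G :
  is_subgroup G -> is_subgroup (integral_units G).
Proof.
move=> [GU G1 GM GV]; split.
- by move=> g [/GU].
- by split=> //; exists 1, 1; rewrite invr1 map_mx1.
- move=> g h [Gg [B [C [gB gC]]]] [Gh [B' [C' [hB hC]]]]; split; first exact: GM.
  exists (B *m B'), (C' *m C); rewrite !map_mxM -gB -gC -hB -hC; split=> //.
  by rewrite invrM //; apply: GU.
- move=> g [Gg [B [C [gB gC]]]]; split; first exact: GV.
  by exists C, B; rewrite invrK.
Qed.

(** The cosets of the [f k] are pairwise distinct, so finitely many cosets would make the set of
    natural numbers finite. *)
Lemma infinite_index_seq H G (f : nat -> 'M[K]_N.+1) :
    is_subgroup H -> (forall k, G (f k)) ->
    (forall k, f k \is a GRing.unit) ->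
    (forall k l, H ((f k)^-1 * f l) -> k = l) ->
  infinite_index H G.
Proof.
move=> [_ H1 _ _] Gf fu f_inj fin.
have /finite_preimage : {in (fun k => lcoset (f k) H) @^-1` lcosets H G &,
    injective (fun k => lcoset (f k) H)}.
  move=> k l _ _ kl; apply: f_inj.
  have : lcoset (f k) H (f l) by rewrite kl; exists 1; rewrite ?mulr1.
  by move=> [h Hh <-]; rewrite mulKr.
move=> /(_ fin) pre_fin; apply: infinite_nat; apply: sub_finite_set pre_fin.
by move=> k _; exists (f k).
Qed.

End SubgroupsOfGL.

(** * The Lie algebra of the Zariski closure *)

Section InfinitePolynomials.
Variable K : numFieldType.

Lemma poly_eq0_mulrn (c : K) (p : {poly K}) :
  c != 0 -> (forall k : nat, p.[k%:R * c] = 0) -> p = 0.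
Proof.
move=> c0 p0.
apply: (@roots_geq_poly_eq0 _ p [seq k%:R * c | k <- iota 0 (size p)]).
- by apply/allP => _ /mapP[k _ ->]; apply/rootP.
- rewrite map_inj_uniq ?iota_uniq // => i j /(mulIf c0) /eqP.
  by rewrite eqr_nat => /eqP.
- by rewrite size_map size_iota.
Qed.

Lemma bipoly_coef_eq0 (c : K) (n : nat) (u : nat -> nat -> K) :
    c != 0 ->
    (forall k l : nat, k != l ->
      \sum_(a < n) \sum_(b < n) (k%:R * c) ^+ a * (l%:R * c) ^+ b * u a b = 0) ->
  forall a b, (a < n)%N -> (b < n)%N -> u a b = 0.
Proof.
move=> c0 u0 a b an bn.
pose p (l : nat) := \poly_(a < n) \sum_(b < n) (l%:R * c) ^+ b * u a b.
have pE l x : (p l).[x] = \sum_(a < n) \sum_(b < n) x ^+ a * (l%:R * c) ^+ b * u a b.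
  rewrite horner_poly; apply: eq_bigr => i _; rewrite mulr_suml.
  by apply: eq_bigr => j _; ring.
have p0 l : p l = 0.
  (* Nothing is known at k = l; the extra linear factor supplies that missing root. *)
  have /eqP : p l * ('X - (l%:R * c)%:P) = 0.
    apply: (poly_eq0_mulrn c0) => k; rewrite hornerM hornerXsubC.
    have [->|kl] := eqVneq k l; first by rewrite subrr mulr0.
    by rewrite pE u0 ?mul0r.
  by rewrite mulf_eq0 polyXsubC_eq0 orbF => /eqP.
have q0 : \poly_(b < n) u a b = 0.
  apply: (poly_eq0_mulrn c0) => l; rewrite horner_poly.
  have /(congr1 (fun q : {poly K} => q`_a)) := p0 l; rewrite coef_poly an coef0.
  by move=> pa0; rewrite -[RHS]pa0; apply: eq_bigr => j _; rewrite mulrC.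
by have /(congr1 (fun q : {poly K} => q`_b)) := q0; rewrite coef_poly bn coef0.
Qed.

End InfinitePolynomials.

(** * Derivations of the coordinate ring of matrices *)

Section Derivations.
Variables (K : numFieldType).

(** Reduces the chain rule and the bracket formula to constants and variables, with the Leibniz rule
    for products. *)
Lemma mpoly_gen_ind n (P : {mpoly K[n]} -> Prop) :
    (forall c, P c%:MP) -> (forall i, P 'X_i) ->
    (forall p q, P p -> P q -> P (p + q)) ->
    (forall p q, P p -> P q -> P (p * q)) ->
  forall p, P p.
Proof.
move=> PC PX PD PM; elim/mpolyind => [|c m p _ _ Pp]; first by rewrite -mpolyC0.
apply: PD => //; rewrite -mul_mpolyC; apply: (PM) => //.
rewrite mpolyXE_id; apply: (big_ind P) => [||i _]; first by rewrite -mpolyC1.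
  exact: PM.
by elim: (m i) => [|k IHk]; rewrite ?expr0 -?mpolyC1 // exprS; apply: PM.
Qed.

Lemma horner_mmap n (h : 'I_n -> {poly K}) p x :
  (mmap polyC h p).[x] = p.@[fun i => (h i).[x]].
Proof.
elim/mpoly_gen_ind: p => [c|i|p q IHp IHq|p q IHp IHq].
- by rewrite mmapC mevalC hornerC.
- by rewrite mmapX mmap1U mevalXU.
- by rewrite rmorphD hornerD IHp IHq mevalD.
- by rewrite rmorphM hornerM IHp IHq mevalM.
Qed.

Lemma mderivU n (i l : 'I_n) : ('X_i : {mpoly K[n]})^`M(l) = (i == l)%:R.
Proof.
rewrite mderivX mnm1E; have [->|_] := eqVneq i l; last by rewrite scale0r.
suff -> : (U_(l) - U_(l) = 0)%MM by rewrite mpolyX0 scale1r.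
by apply/mnmP => j; rewrite mnmBE mnm0E subnn.
Qed.

(** The chain rule along the polynomial curve [h]. *)
Lemma deriv_mmap n (h : 'I_n -> {poly K}) p :
  (mmap polyC h p)^`() = \sum_l mmap polyC h p^`M(l) * (h l)^`().
Proof.
elim/mpoly_gen_ind: p => [c|i|p q IHp IHq|p q IHp IHq].
- by rewrite mmapC derivC big1 // => l _; rewrite mderivC mmap0 mul0r.
- rewrite mmapX mmap1U (bigD1 i) //= big1 ?addr0 => [|l li].
    by rewrite mderivU eqxx rmorph1 mul1r.
  by rewrite mderivU eq_sym (negbTE li) mmap0 mul0r.
- rewrite rmorphD derivD IHp IHq -big_split; apply: eq_bigr => l _ /=.
  by rewrite mderivD rmorphD mulrDl.
- rewrite rmorphM derivM IHp IHq mulr_suml mulr_sumr -big_split.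
  apply: eq_bigr => l _ /=; rewrite mderivM rmorphD !rmorphM; ring.
Qed.

Variable N : nat.
Local Notation M := 'M[K]_N.+1.
Local Notation P := {mpoly K[N.+1 * N.+1]}.

Definition generic_mx : 'M[P]_N.+1 := vec_mx (\row_l 'X_l).

Fact rder_key : unit. Proof. by []. Qed.

(* The vector field g |-> g X, seen as a derivation of the coordinate ring. *)
Definition rder (X : M) (p : P) : P := locked_with rder_key
  (\sum_l p^`M(l) * mxvec (generic_mx *m map_mx (@mpolyC _ _) X) 0 l).

Lemma rderE X p : rder X p =
  \sum_l p^`M(l) * mxvec (generic_mx *m map_mx (@mpolyC _ _) X) 0 l.
Proof. by rewrite /rder unlock. Qed.

Lemma generic_mxE i j : generic_mx i j = 'X_(mxvec_index i j).
Proof. by rewrite !mxE. Qed.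

Lemma peval_rder (X : M) p g :
  peval (rder X p) g = \sum_l peval p^`M(l) g * mxvec (g *m X) 0 l.
Proof.
rewrite rderE /peval rmorph_sum; apply: eq_bigr => l _; rewrite rmorphM; congr (_ * _).
case/mxvec_indexP: l => i j; rewrite !mxvecE !mxE rmorph_sum.
apply: eq_bigr => k _; rewrite rmorphM generic_mxE mxE /= mevalXU mxvecE.
by congr (_ * _); rewrite mevalC.
Qed.

Lemma peval_rder_linear p g a (X Y : M) :
  peval (rder (a *: X + Y) p) g = a * peval (rder X p) g + peval (rder Y p) g.
Proof.
have sumL (J : finType) (d v w : J -> K) :
    a * (\sum_l d l * v l) + \sum_l d l * w l = \sum_l d l * (a * v l + w l).
  by rewrite mulr_sumr -big_split; apply: eq_bigr => l _ /=; ring.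
apply: etrans (peval_rder _ p g) _; apply: esym.
apply: etrans (congr2 _ (congr1 _ (peval_rder X p g)) (peval_rder Y p g)) _.
apply: etrans (sumL _ _ _ _) _; apply: eq_bigr => l _; congr (_ * _).
by rewrite mulmxDr -scalemxAr linearP mxE mxE.
Qed.

Lemma rderC X c : rder X c%:MP = 0.
Proof. by rewrite rderE big1 // => l _; rewrite mderivC mul0r. Qed.

Lemma rder0 X : rder X 0 = 0.
Proof. by rewrite -mpolyC0 rderC. Qed.

Lemma rderD X p q : rder X (p + q) = rder X p + rder X q.
Proof.
rewrite !rderE -big_split; apply: eq_bigr => l _ /=.
by rewrite mderivD mulrDl.
Qed.

Lemma rderM X p q : rder X (p * q) = rder X p * q + p * rder X q.
Proof.
rewrite !rderE mulr_suml mulr_sumr -big_split; apply: eq_bigr => l _ /=.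
by rewrite mderivM; ring.
Qed.

Lemma rder_sum X (J : Type) (r : seq J) (F : J -> P) :
  rder X (\sum_(j <- r) F j) = \sum_(j <- r) rder X (F j).
Proof. exact: (big_morph _ (rderD X) (rder0 X)). Qed.

Lemma rderU X l :
  rder X 'X_l = mxvec (generic_mx *m map_mx (@mpolyC _ _) X) 0 l.
Proof.
rewrite rderE (bigD1 l) //= big1 ?addr0 => [|k kl].
  by rewrite mderivU eqxx mul1r.
by rewrite mderivU eq_sym (negbTE kl) mul0r.
Qed.

(** Coordinates are linear functions of the matrix, so on them derivations compose like the matrices
    themselves. *)
Lemma rder_rderU X Y l :
  rder X (rder Y 'X_l) = rder (X *m Y) 'X_l.
Proof.
rewrite !rderU map_mxM mulmxA.
case/mxvec_indexP: l => i j; rewrite !mxvecE !mxE rder_sum.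
apply: eq_bigr => k _.
by rewrite generic_mxE [map_mx _ _ _ _]mxE rderM rderC mulr0 addr0 rderU mxvecE.
Qed.

(** Both sides are derivations, so it is enough to compare them on the coordinates, where
    [rder_rderU] applies. *)
Lemma rder_bracket X Y p :
  rder X (rder Y p) - rder Y (rder X p) = rder (X *m Y - Y *m X) p.
Proof.
have B0 (A B : M) q : rder (A - B) q = rder A q - rder B q.
  rewrite !rderE -sumrB; apply: eq_bigr => l _.
  by rewrite map_mxB mulmxBr linearB mxE mxE mulrBr.
elim/mpoly_gen_ind: p => [c|l|p q IHp IHq|p q IHp IHq].
- by rewrite (rderC Y) (rderC X c) !rder0 rderC subrr.
- by rewrite !rder_rderU B0.
- by rewrite [RHS]rderD -IHp -IHq !rderD opprD addrACA.
- rewrite [RHS]rderM -IHp -IHq !rderM !rderD !rderM.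
  move: (rder X (rder Y p)) (rder Y (rder X p)) (rder X (rder Y q)) => a b c.
  move: (rder Y (rder X q)) (rder X p) (rder Y p) (rder X q) (rder Y q) => d e f g h.
  ring.
Qed.

Definition line_poly p (g X : M) : {poly K} :=
  mmap polyC (fun l => (mxvec g 0 l)%:P + (mxvec (g *m X) 0 l) *: 'X) p.

Lemma line_polyE p g X c : (line_poly p g X).[c] = peval p (g *m (1 + c *: X)).
Proof.
rewrite horner_mmap; apply: meval_eq => l.
by rewrite mulmxDr mulmx1 -scalemxAr !linearE /= !mxE !hornerE mulrC.
Qed.

Lemma horner_deriv_line_poly p g X c :
  ((line_poly p g X)^`()).[c] =
  \sum_l peval p^`M(l) (g *m (1 + c *: X)) * mxvec (g *m X) 0 l.
Proof.
rewrite deriv_mmap horner_sum; apply: eq_bigr => l _.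
rewrite hornerM -/(line_poly _ _ _) line_polyE; congr (_ * _).
by rewrite derivD derivC derivZ derivX !hornerE.
Qed.

Lemma deriv_line_poly0 p g X :
  ((line_poly p g X)^`()).[0] = peval (rder X p) g.
Proof. by rewrite horner_deriv_line_poly scale0r addr0 mulmx1 peval_rder. Qed.

(** As X^2 = 0, the direction g X of the line equals g (1 + c X) X at each of its points: the line
    is an integral curve of the vector field of X. *)
Lemma deriv_line_poly p g X :
  X *m X = 0 -> (line_poly p g X)^`() = line_poly (rder X p) g X.
Proof.
move=> XX; apply/subr0_eq/(@poly_eq0_mulrn _ 1); first exact: oner_neq0.
move=> k; rewrite hornerD hornerN line_polyE horner_deriv_line_poly peval_rder.
by rewrite -mulmxA mulmxDl mul1mx -scalemxAl XX scaler0 addr0 subrr.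
Qed.

(** Each iterated derivative is the line polynomial of another element of [I], so it vanishes at 0;
    in characteristic 0 this kills every coefficient. *)
Lemma line_poly_eq0 (I : set P) g X :
    X *m X = 0 -> (forall p, I p -> I (rder X p)) ->
    (forall p, I p -> peval p g = 0) ->
  forall p, I p -> line_poly p g X = 0.
Proof.
move=> XX XI Ig p Ip; apply/polyP => n; rewrite coef0.
have dn : exists2 q, I q & (line_poly p g X)^`(n) = line_poly q g X.
  elim: n => [|n [q Iq qE]]; first by exists p.
  by exists (rder X q); [exact: XI | rewrite derivnS qE deriv_line_poly].
have [q Iq qE] := dn; have /eqP : (line_poly q g X)`_0 = 0.
  by rewrite -horner_coef0 line_polyE scale0r addr0 mulmx1 Ig.
rewrite -qE coef_derivn addn0 ffactnn mulrn_eq0.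
by rewrite eqn0Ngt fact_gt0 => /eqP.
Qed.

End Derivations.

(** * Tangent directions and unipotent elements of the closure *)

Section ZariskiLie.
Variables (K : numFieldType) (N : nat) (H : set 'M[K]_N.+1).
Local Notation P := {mpoly K[N.+1 * N.+1]}.

Definition vanishing : set P := [set p | forall g, H g -> peval p g = 0].

Definition zariski_lie : set 'M[K]_N.+1 :=
  [set X | forall p, vanishing p -> vanishing (rder X p)].

Lemma zariski_closureP g :
  zariski_closure H g <-> forall p, vanishing p -> peval p g = 0.
Proof.
split=> [clg p pH|Hg Z [[I ->] HI] p Ip]; last first.
  by apply: Hg => h Hh; apply: (HI h Hh).
apply: (clg [set g | forall q, vanishing q -> peval q g = 0]) => //.
by split; [exists vanishing | move=> h Hh q; apply].
Qed.

Lemma zariski_lie_lin a X Y :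
  zariski_lie X -> zariski_lie Y -> zariski_lie (a *: X + Y).
Proof.
move=> LX LY p Ip g Hg.
apply: etrans (peval_rder_linear p g a X Y) _.
apply: etrans (congr2 _ (congr1 _ (LX p Ip g Hg)) (LY p Ip g Hg)) _.
by rewrite mulr0 addr0.
Qed.

Lemma zariski_lie0 : zariski_lie 0.
Proof.
move=> p Ip g Hg; rewrite peval_rder mulmx0 big1 // => l _.
by rewrite linear0 mxE mulr0.
Qed.

Lemma zariski_lieZ a X : zariski_lie X -> zariski_lie (a *: X).
Proof.
by move=> LX; rewrite -[_ *: _]addr0; apply: zariski_lie_lin (zariski_lie0).
Qed.

Lemma zariski_lieD X Y : zariski_lie X -> zariski_lie Y -> zariski_lie (X + Y).
Proof. by move=> LX LY; rewrite -[X]scale1r; apply: zariski_lie_lin. Qed.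

Lemma zariski_lieB X Y : zariski_lie X -> zariski_lie Y -> zariski_lie (X - Y).
Proof.
by move=> LX LY; rewrite -scaleN1r addrC; apply: zariski_lie_lin.
Qed.

Lemma zariski_lie_sum (J : finType) (Q : pred J) (F : J -> 'M[K]_N.+1) :
  (forall j, Q j -> zariski_lie (F j)) -> zariski_lie (\sum_(j | Q j) F j).
Proof.
move=> LF; apply: (big_ind zariski_lie zariski_lie0 _ LF).
exact: zariski_lieD.
Qed.

Lemma zariski_lie_bracket X Y :
  zariski_lie X -> zariski_lie Y -> zariski_lie (X *m Y - Y *m X).
Proof.
move=> LX LY p Ip g Hg; rewrite -rder_bracket /peval mevalB.
apply: etrans (congr2 _ (LX _ (LY _ Ip) _ Hg) (congr1 _ (LY _ (LX _ Ip) _ Hg))) _.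
by rewrite subrr.
Qed.

(** If p vanishes on [H] and g is in [H], then p has infinitely many zeros on the line g (1 + x X),
    so it is zero on the line, and so is its derivative at g. *)
Lemma zariski_lie_unipotent c X :
    c != 0 -> (forall g h, H g -> H h -> H (g * h)) -> 
    (forall k : nat, H (1 + (k%:R * c) *: X)) ->
  zariski_lie X.
Proof.
move=> c0 HM HX p Ip g Hg; rewrite -deriv_line_poly0.
suff -> : line_poly p g X = 0 by rewrite deriv0 horner0.
by apply: (poly_eq0_mulrn c0) => k; rewrite line_polyE; apply/Ip/HM.
Qed.

(* Taylor's formula: X^2 = 0 makes the derivatives of c |-> p (g (1 + c X))
   at 0 the values at g of the iterates of the derivation of X. *)
Lemma zariski_closure_unipotent X c g :
    zariski_lie X -> X *m X = 0 -> zariski_closure H g ->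
  zariski_closure H (g * (1 + c *: X)).
Proof.
move=> LX XX /zariski_closureP clg; apply/zariski_closureP => p Ip.
by rewrite -[g * _]/(g *m _) -line_polyE (line_poly_eq0 XX LX clg) // horner0.
Qed.

End ZariskiLie.

(** * The one-parameter groups *)

Section ExponentialMatrices.
Variables (K : numFieldType) (N : nat).

Definition expcoef (t : K) (k : nat) : K := t ^+ k / k`!%:R.

Lemma expcoef0 (t : K) : expcoef t 0 = 1.
Proof. by rewrite /expcoef expr0 fact0 divr1. Qed.

Lemma expcoef0n k : expcoef 0 k = (k == 0)%:R.
Proof. by rewrite /expcoef expr0n; case: k => [|k]; rewrite ?fact0 ?divr1 ?mul0r. Qed.

Lemma factr_neq0 n : n`!%:R != 0 :> K.
Proof. by rewrite pnatr_eq0 -lt0n fact_gt0. Qed.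

(** The binomial theorem divided by n!. *)
Lemma expcoefD (s t : K) n :
  \sum_(k < n.+1) expcoef s k * expcoef t (n - k) = expcoef (s + t) n.
Proof.
rewrite /expcoef addrC exprDn mulr_suml; apply: eq_bigr => k _.
have kn : (k <= n)%N by rewrite -ltnS.
have /(congr1 (fun m => m%:R : K)) := bin_fact kn; rewrite !natrM => nE.
rewrite -[_ *+ 'C(n, k)]mulr_natr -nE.
field; rewrite !factr_neq0 /= pnatr_eq0 -lt0n bin_gt0; exact: kn.
Qed.

Lemma amxE (t : K) (i j : 'I_N.+1) :
  amx N t i j = if (i <= j)%N then expcoef t (j - i) else 0.
Proof.
rewrite amx_exp summxE.
under eq_bigr do rewrite exprZn !mxE xmx_expE.
case: leqP => ij; last first.
  by rewrite big1 // => k _; rewrite ltn_eqF ?mulr0 // ltn_addr.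
have dN : (j - i < N.+1)%N by rewrite (leq_ltn_trans (leq_subr _ _)).
rewrite (bigD1 (Ordinal dN)) //= subnKC // eqxx mulr1 big1 ?addr0.
  by rewrite mulrC.
move=> k kd; case: eqP => [e|_]; last by rewrite !mulr0.
by case/eqP: kd; apply: val_inj; rewrite /= e addKn.
Qed.

Lemma amxD (s t : K) : amx N s *m amx N t = amx N (s + t).
Proof.
apply/matrixP => i j; rewrite mxE amxE.
under eq_bigr do rewrite !amxE.
case: leqP => ij; last first.
  rewrite big1 // => k _; case: leqP => ik; rewrite ?mul0r //.
  by case: leqP => kj; rewrite ?mulr0 //; lia.
rewrite -expcoefD.
(* Only the indices k = i + m with m <= j - i contribute, which gives the sum of [expcoefD]. *)
rewrite (bigID (fun k : 'I_N.+1 => (i <= k <= j)%N)) /= [X in _ + X]big1 ?addr0.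
  2: by move=> k; case: (leqP i k) => ik; case: (leqP k j); rewrite ?mulr0 ?mul0r.
have jiN (m : 'I_(j - i).+1) : (i + m < N.+1)%N.
  by have := ltn_ord j; have := ltn_ord m; lia.
rewrite (reindex_onto (fun m : 'I_(j - i).+1 => inord (i + m))
           (fun k : 'I_N.+1 => inord (k - i))) /=; last first.
  move=> k /andP[ik kj]; apply: val_inj; have := ltn_ord k => kN.
  by rewrite /= [X in (i + X)%N]inordK ?inordK; lia.
apply: eq_big => [m|m _].
  rewrite inordK // addKn inord_val eqxx andbT leq_addr /=.
  by have := ltn_ord m; lia.
rewrite inordK // addKn leq_addr.
have -> : (i + m <= j)%N by have := ltn_ord m; lia.
by rewrite subnDA.
Qed.

Lemma amx0 : amx N (0 : K) = 1.
Proof.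
apply/matrixP => i j; rewrite amxE mxE expcoef0n subn_eq0 -(inj_eq val_inj) /=.
by rewrite eqn_leq; case: leqP.
Qed.

Lemma amxVr (t : K) : amx N t *m amx N (- t) = 1.
Proof. by rewrite amxD subrr amx0. Qed.

Lemma amxVl (t : K) : amx N (- t) *m amx N t = 1.
Proof. by rewrite amxD addNr amx0. Qed.

Lemma amx_unit (t : K) : amx N t \is a GRing.unit.
Proof. by apply/unitrP; exists (amx N (- t)); split; [exact: amxVl | exact: amxVr]. Qed.

Lemma amxV (t : K) : (amx N t)^-1 = amx N (- t).
Proof.
by apply: (mulrI (amx_unit t)); rewrite divrr ?amx_unit //; apply/esym/amxVr.
Qed.

Lemma amxXn (t : K) (k : nat) : amx N t ^+ k = amx N (k%:R * t).
Proof.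
elim: k => [|k IHk]; first by rewrite expr0 mul0r amx0.
by rewrite exprS IHk [_ * _]amxD -natr1 addrC mulrDl mul1r.
Qed.

Lemma amxXz (t : K) (k : int) : amx N t ^ k = amx N (k%:~R * t).
Proof.
case: k => k; first exact: amxXn.
by rewrite NegzE -exprnN amxXn amxV // mulrNz mulNr.
Qed.

Lemma ymx_sq : (0 < N)%N -> ymx K N *m ymx K N = 0.
Proof.
by move=> N0; rewrite mul_delta_mx_cond -(inj_eq val_inj) /= (ltn_eqF N0) mulr0n.
Qed.

Lemma mul_bmx (s t : K) : (0 < N)%N -> bmx N s *m bmx N t = bmx N (s + t).
Proof.
move=> N0; rewrite mulmxDl mul1mx mulmxDr mulmx1 -scalemxAr -scalemxAl ymx_sq //.
by rewrite !scaler0 addr0 /bmx scalerDl -addrA [s *: _ + _]addrC.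
Qed.

Lemma bmx0 : bmx N (0 : K) = 1.
Proof. by rewrite /bmx scale0r addr0. Qed.

Lemma bmx_unit (s : K) : (0 < N)%N -> bmx N s \is a GRing.unit.
Proof.
by move=> N0; apply/unitrP; exists (bmx N (- s)); split;
   apply: etrans (mul_bmx _ _ N0) _; rewrite ?subrr ?addNr bmx0.
Qed.

Lemma bmxV (s : K) : (0 < N)%N -> (bmx N s)^-1 = bmx N (- s).
Proof.
move=> N0; apply: (mulrI (bmx_unit s N0)); rewrite divrr ?bmx_unit //.
by rewrite [RHS]mul_bmx // subrr bmx0.
Qed.

Lemma bmxXn (s : K) (k : nat) : (0 < N)%N -> bmx N s ^+ k = bmx N (k%:R * s).
Proof.
move=> N0; elim: k => [|k IHk]; first by rewrite expr0 mul0r bmx0.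
by rewrite exprS IHk [_ * _]mul_bmx // -natr1 addrC mulrDl mul1r.
Qed.

Lemma bmxXz (s : K) (k : int) : (0 < N)%N -> bmx N s ^ k = bmx N (k%:~R * s).
Proof.
move=> N0; case: k => k; first exact: bmxXn.
by rewrite NegzE -exprnN bmxXn // bmxV // mulrNz mulNr.
Qed.

Definition conj_y (z : K) : 'M[K]_N.+1 := amx N z *m ymx K N *m amx N (- z).

(** y is the last basis column times the first basis row, so its conjugate is the last column of
    a(z) times the first row of a(-z). *)
Lemma conj_yE z i j : conj_y z i j = expcoef z (N - i) * expcoef (- z) j.
Proof.
rewrite /conj_y /ymx -[delta_mx _ _](mul_delta_mx (0 : 'I_1)) mulmxA -mulmxA mxE.
rewrite big_ord1 -rowE -colE [col _ _ _ _]mxE [row _ _ _ _]mxE !amxE /= subn0.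
by have -> : (i <= N)%N by rewrite -ltnS.
Qed.

Lemma unipotent_conj_y c z :
  1 + c *: conj_y z = amx N z * bmx N c * (amx N z)^-1.
Proof.
rewrite amxV /bmx /conj_y; have := amxVr z; move: (amx N z) (amx N (- z)) => A B AB.
rewrite mulrDr mulr1 mulrDl [A * B]AB.
by rewrite -scalerAr -scalerAl.
Qed.

End ExponentialMatrices.

(** * The Lie algebra of the pair a(t), b(s) *)

Section ReversedIndices.
Variable N : nat.

Lemma rev_ord_eq0 (i : 'I_N.+1) : (rev_ord i == ord0) = (i == ord_max).
Proof. rewrite -!(inj_eq val_inj) /=; have := ltn_ord i; lia. Qed.

Lemma rev_ord_eq_max (i : 'I_N.+1) : (rev_ord i == ord_max) = (i == ord0).
Proof. rewrite -!(inj_eq val_inj) /=; have := ltn_ord i; lia. Qed.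

Lemma rev_ord0 : rev_ord (ord0 : 'I_N.+1) = ord_max.
Proof. by apply: val_inj; rewrite /= subn1. Qed.

Lemma rev_ord_max : rev_ord (ord_max : 'I_N.+1) = ord0.
Proof. by apply: val_inj; rewrite /= subnn. Qed.

Lemma max_neq0 : (0 < N)%N -> (ord_max == ord0 :> 'I_N.+1) = false.
Proof. by move=> N0; rewrite -(inj_eq val_inj) gtn_eqF. Qed.

End ReversedIndices.

Section PairMatrices.
Variables (K : numFieldType) (N : nat).
Local Notation e := (@delta_mx K N.+1 N.+1).

Lemma expcoefN (z : K) k : expcoef (- z) k = (-1) ^+ k * expcoef z k :> K.
Proof. by rewrite /expcoef [in LHS]exprNn mulrA. Qed.

(** The first row of a(-z) times the last column of a(w) is the upper right corner entry of a(w -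
    z). *)
Lemma mul_conj_y (z w : K) i j :
  (conj_y N z *m conj_y N w) i j =
  expcoef (w - z) N * (expcoef z (N - i) * expcoef (- w) j).
Proof.
rewrite mxE; under eq_bigr do rewrite !conj_yE.
rewrite [w - z]addrC -expcoefD mulr_suml; apply: eq_bigr => k _.
by ring.
Qed.

Lemma sum_pick (f : nat -> K) (i : 'I_N.+1) :
  \sum_(a < N.+1) f a * (i == a :> nat)%:R = f i.
Proof.
rewrite (bigD1 i) //= eqxx mulr1 big1 ?addr0 // => a ai.
by rewrite [_ == _ :> nat]eq_sym (inj_eq val_inj) (negbTE ai) mulr0.
Qed.

Lemma sum_pick_rev (f : nat -> K) (i : 'I_N.+1) :
  \sum_(a < N.+1) f a * (i == N - a :> nat)%N%:R = f (N - i)%N.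
Proof.
rewrite (reindex_inj rev_ord_inj) -(sum_pick (fun a => f (N - a)%N) i) /=.
apply: eq_bigr => a _; rewrite subSS; congr (_ * (_ == _)%:R).
by rewrite subKn // -ltnS.
Qed.

Lemma bracket_delta i j k l :
  e i j *m e k l - e k l *m e i j =
  (j == k)%:R *: e i l - (l == i)%:R *: e k j.
Proof. by rewrite !mul_delta_mx_cond -!scaler_nat. Qed.

Lemma signN_even i : ~~ odd N -> (-1) ^+ (i + N) = (-1) ^+ i :> K.
Proof. by move=> Ne; rewrite -signr_odd oddD (negbTE Ne) addbF signr_odd. Qed.

(* The Lie algebra of the form J when N is odd, and of the symmetric form with
   the same matrix when N is even, is spanned by these matrices. *)
Definition rev_skew (i j : 'I_N.+1) : 'M[K]_N.+1 :=
  e i j - (-1) ^+ (i + j) *: e (rev_ord j) (rev_ord i).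

End PairMatrices.

Arguments rev_skew {K N} i j.

Section LieAlgebraOfThePair.
Variables (K : numFieldType) (N : nat) (H : set 'M[K]_N.+1) (t s : K).
Hypotheses (N0 : (0 < N)%N) (H_group : is_subgroup H) (t0 : t != 0) (s0 : s != 0).
Hypotheses (Ha : H (amx N t)) (Hb : H (bmx N s)).
Local Notation L := (zariski_lie H).
Local Notation e := (@delta_mx K N.+1 N.+1).

Lemma subgroupM g h : H g -> H h -> H (g * h).
Proof. by case: H_group => _ _ HM _; apply: HM. Qed.

Lemma subgroupX g (k : nat) : H g -> H (g ^+ k).
Proof.
move=> Hg; elim: k => [|k IHk]; first by case: H_group.
by rewrite exprS; apply: subgroupM.
Qed.

Lemma zariski_lie_conj_y (k : nat) : L (conj_y N (k%:R * t)).
Proof.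
apply: (@zariski_lie_unipotent _ _ _ s) => // [g h|l]; first exact: subgroupM.
rewrite unipotent_conj_y -amxXn -bmxXn //; apply: subgroupM.
  by apply: subgroupM; apply: subgroupX.
by case: H_group => _ _ _; apply; apply: subgroupX.
Qed.

Lemma zariski_lie_ymx : L (ymx K N).
Proof.
have := zariski_lie_conj_y 0.
by rewrite mul0r /conj_y oppr0 amx0 mulmx1 mul1mx.
Qed.

Lemma peval_rder_sum p g n (c : 'I_n -> K) (X : 'I_n -> 'M[K]_N.+1) :
  peval (rder (\sum_j c j *: X j) p) g = \sum_j c j * peval (rder (X j) p) g.
Proof.
have r0 : peval (rder 0 p) g = 0.
  have := peval_rder_linear p g (-1) 0 0.
  by rewrite scaler0 addr0 mulN1r addNr.
elim: n c X => [|n IHn] c X; first by rewrite !big_ord0 r0.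
by rewrite big_ord_recl [RHS]big_ord_recl -IHn; exact: peval_rder_linear.
Qed.

(** Membership in [L] is the vanishing of the numbers [peval (rder X p) g], which are linear in X;
    [bipoly_coef_eq0] is applied for each p and g. Leaving out k = l allows a division by w - z. *)
Lemma zariski_lie_coef n (X : nat -> nat -> 'M[K]_N.+1) :
    (forall k l : nat, k != l ->
      L (\sum_(a < n) (k%:R * t) ^+ a *: \sum_(b < n) (l%:R * t) ^+ b *: X a b)) ->
  forall a b, (a < n)%N -> (b < n)%N -> L (X a b).
Proof.
move=> LX a b an bn p Ip g Hg.
pose u a b := peval (rder (X a b) p) g.
apply: (@bipoly_coef_eq0 _ t n u t0 _ a b an bn) => k l kl.
rewrite -[RHS](LX k l kl p Ip g Hg) peval_rder_sum; apply: eq_bigr => i _.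
rewrite peval_rder_sum mulr_sumr; apply: eq_bigr => j _.
by rewrite mulrA.
Qed.

Lemma zariski_lie_rev_skew i j : L (rev_skew i j).
Proof.
pose c a : K := (a`!%:R)^-1.
(* This is the coefficient of z^a w^b in the bracket of [conj_y N z] and [conj_y N w], once the
   factor [expcoef (w - z) N] is divided out. *)
pose X a b : 'M[K]_N.+1 := (c a * c b) *:
  ((-1) ^+ b *: e (inord (N - a)) (inord b) -
   (-1) ^+ (N + a) *: e (inord (N - b)) (inord a)).
have LX : forall a b, (a < N.+1)%N -> (b < N.+1)%N -> L (X a b).
  apply: zariski_lie_coef => k l kl; set z := k%:R * t; set w := l%:R * t.
  have wz0 : expcoef (w - z) N != 0.
    rewrite /expcoef mulf_neq0 ?invr_neq0 ?factr_neq0 // expf_neq0 //.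
    by rewrite -mulrBl mulf_neq0 // subr_eq0 eqr_nat eq_sym.
  suff -> : \sum_(a < N.+1) z ^+ a *: (\sum_(b < N.+1) w ^+ b *: X a b) =
      (expcoef (w - z) N)^-1 *:
      (conj_y N z *m conj_y N w - conj_y N w *m conj_y N z).
    by apply/zariski_lieZ/zariski_lie_bracket; apply: zariski_lie_conj_y.
  have wzE : expcoef (z - w) N = (-1) ^+ N * expcoef (w - z) N.
    by rewrite -opprB expcoefN.
  apply/matrixP => i' j'.
  rewrite [RHS]mxE [X in _ = _ * X]mxE [X in _ = _ * (_ + X)]mxE !mul_conj_y wzE.
  (* Written this way each double sum splits into a product of two simple sums, in which a single
     index survives. *)
  transitivity (\sum_(a < N.+1) \sum_(b < N.+1)
      ((expcoef z a * (i' == N - a :> nat)%N%:R) *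
         (expcoef w b * (-1) ^+ b * (j' == b :> nat)%:R)
       - (-1) ^+ N * (expcoef z a * (-1) ^+ a * (j' == a :> nat)%:R) *
         (expcoef w b * (i' == N - b :> nat)%N%:R))).
    rewrite summxE; apply: eq_bigr => m _; rewrite mxE summxE mulr_sumr.
    apply: eq_bigr => q _; rewrite !mxE -!(inj_eq val_inj) /=.
    rewrite !inordK ?ltnS ?leq_subr ?leq_ord // -!mulnb !natrM /expcoef /c exprD; ring.
  under eq_bigr do rewrite sumrB.
  rewrite sumrB -big_distrlr /=.
  under [X in _ - X]eq_bigr do rewrite -mulr_sumr.
  rewrite -mulr_suml -mulr_sumr (sum_pick_rev (expcoef z)) (sum_pick_rev (expcoef w)).
  rewrite (sum_pick (fun a => expcoef z a * (-1) ^+ a)).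
  rewrite (sum_pick (fun a => expcoef w a * (-1) ^+ a)).
  rewrite !expcoefN; move: wz0; set E := expcoef _ N => E0.
  by field.
have iE : inord (N - (N - i)) = i.
  by apply: val_inj; rewrite subKn ?inord_val // -ltnS.
have -> : rev_skew i j = ((-1) ^+ j * (c (N - i)%N * c j)^-1) *: X (N - i)%N j.
  rewrite /X scalerA -mulrA mulVf ?mulf_neq0 ?invr_neq0 ?factr_neq0 // mulr1.
  rewrite scalerBr !scalerA -expr2 sqrr_sign scale1r iE inord_val.
  congr (_ - _ *: delta_mx _ _).
  - rewrite -signr_odd -[RHS]exprD -[RHS]signr_odd; congr (_ ^+ (nat_of_bool _)).
    have := ltn_ord i; rewrite !oddD; lia.
  - by apply: val_inj; rewrite /= inordK; have := ltn_ord j; lia.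
  - by apply: val_inj; rewrite /= inordK; have := ltn_ord i; lia.
by apply/zariski_lieZ/LX; rewrite ltnS ?leq_subr ?leq_ord.
Qed.

(** The symmetry makes the second terms of the [rev_skew i j], weighted by the entries of X, add up
    to X once more, whence the factor 1/2. For odd N the symmetry defines the Lie algebra of the
    form J. *)
Lemma zariski_lie_sp (X : 'M[K]_N.+1) :
    (forall i j, X i j = - ((-1) ^+ (i + j) * X (rev_ord j) (rev_ord i))) ->
  L X.
Proof.
move=> XE; have -> : X = 2^-1 *: \sum_i \sum_j X i j *: rev_skew i j.
  under eq_bigr do under eq_bigr do rewrite scalerBr scalerA.
  under eq_bigr do rewrite sumrB.
  rewrite sumrB -matrix_sum_delta.
  have -> : \sum_i \sum_j (X i j * (-1) ^+ (i + j)) *: e (rev_ord j) (rev_ord i) = - X.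
    rewrite [in RHS](matrix_sum_delta X) exchange_big /=.
    rewrite (reindex_inj rev_ord_inj) -sumrN.
    apply: eq_bigr => i _; rewrite (reindex_inj rev_ord_inj) -sumrN.
    apply: eq_bigr => j _; rewrite !rev_ordK XE !rev_ordK mulNr scaleNr.
    congr (- (_ *: _)).
    by rewrite mulrAC -exprD addnn -signr_odd odd_double mul1r.
  rewrite opprK -mulr2n -scaler_nat scalerA mulVf ?scale1r //.
  by rewrite pnatr_eq0.
apply: zariski_lieZ; apply: zariski_lie_sum => i _; apply: zariski_lie_sum => j _.
exact/zariski_lieZ/zariski_lie_rev_skew.
Qed.

(** * Matrices of odd size: all of sl_n *)

Section EvenN.
Hypotheses (N_even : ~~ odd N) (N1 : (1 < N)%N).

Lemma zariski_lieZK a X : a != 0 -> L (a *: X) -> L X.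
Proof.
move=> a0 LX; have := zariski_lieZ a^-1 LX.
by rewrite scalerA (mulVf a0) scale1r.
Qed.

(** Bracketing [rev_skew i ord_max] with y gives the two terms of [rev_skew i ord0] with the
    opposite relative sign; the sum is 2 e_{i,0}. Here y, which is not skew for the symmetric form,
    breaks that symmetry. *)
Lemma zariski_lie_delta_i0 i : i != ord0 -> L (e i ord0).
Proof.
move=> i0.
have := zariski_lie_bracket (zariski_lie_rev_skew i ord_max) zariski_lie_ymx.
move/(zariski_lieD (zariski_lie_rev_skew i ord0)).
rewrite /rev_skew /ymx rev_ord_max rev_ord0 addn0 (signN_even _ _ N_even).
rewrite mulmxBl mulmxBr -scalemxAl -scalemxAr opprB addrA.
rewrite !mul_delta_mx_cond !eqxx [ord0 == i]eq_sym (negbTE i0).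
rewrite rev_ord_eq_max (negbTE i0).
rewrite !mulr0n !mulr1n scaler0 !subr0.
set A := e i ord0; set B := _ *: _ => LA.
apply: (@zariski_lieZK 2); first by rewrite pnatr_eq0.
by move: LA; rewrite addrAC subrK -mulr2n -scaler_nat.
Qed.

Lemma zariski_lie_delta_h i : i != ord0 -> i != ord_max ->
  L (e ord0 ord0 - e i i).
Proof.
move=> i0 iN.
have := zariski_lie_bracket (zariski_lie_rev_skew ord0 i) (zariski_lie_delta_i0 i0).
rewrite /rev_skew rev_ord0 mulmxBl mulmxBr -scalemxAl -scalemxAr.
rewrite !mul_delta_mx_cond !eqxx [ord_max == i]eq_sym (negbTE iN) [ord0 == _]eq_sym.
rewrite rev_ord_eq0 (negbTE iN) !mulr0n !mulr1n scaler0 !subr0; exact: id.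
Qed.

Lemma zariski_lie_delta_0i i : i != ord0 -> i != ord_max -> L (e ord0 i).
Proof.
move=> i0 iN.
have LF := zariski_lie_rev_skew ord0 i.
have := zariski_lie_bracket (zariski_lie_delta_h i0 iN) LF.
rewrite /rev_skew rev_ord0 !(mulmxBl, mulmxBr) -!scalemxAl -!scalemxAr.
rewrite !mul_delta_mx_cond !eqxx (negbTE i0) (max_neq0 N0).
rewrite [ord_max == i]eq_sym (negbTE iN).
rewrite [ord0 == rev_ord _]eq_sym rev_ord_eq0 (negbTE iN).
rewrite !mulr0n !mulr1n !scaler0 ?subr0 ?sub0r ?oppr0 ?add0r ?addr0.
(* For the middle index a term in e_{i,N} survives in the bracket; adding [rev_skew ord0 i] cancels
   it and leaves 3 e_{0,i} in place of 2 e_{0,i}. *)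
have [ii|_] := eqVneq i (rev_ord i).
  move=> L2; apply: (@zariski_lieZK 3); first by rewrite pnatr_eq0.
  move: (zariski_lieD L2 LF); rewrite /rev_skew rev_ord0 -ii mulr1n !opprK.
  rewrite [X in X + (_ - _)]addrAC addrACA subrr addr0 -mulr2n -mulrSr.
  by rewrite -scaler_nat.
move=> L2; apply: (@zariski_lieZK 2); first by rewrite pnatr_eq0.
move: L2; rewrite mulr0n scaler0 !oppr0 addr0 opprK.
by rewrite -mulr2n -scaler_nat.
Qed.

Lemma zariski_lie_delta_iN i : i != ord0 -> i != ord_max -> L (e i ord_max).
Proof.
move=> i0 iN.
have i0' : rev_ord i != ord0 by rewrite rev_ord_eq0.
have iN' : rev_ord i != ord_max by rewrite rev_ord_eq_max.
have := zariski_lieB (zariski_lie_delta_0i i0' iN')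
          (zariski_lie_rev_skew ord0 (rev_ord i)).
rewrite /rev_skew rev_ord0 rev_ordK opprB addrC subrK; apply: zariski_lieZK.
by rewrite signr_eq0.
Qed.

Lemma zariski_lie_delta_0N : L (e ord0 ord_max).
Proof.
(* An index strictly between 0 and N; it exists because N > 1. *)
pose i : 'I_N.+1 := inord 1.
have i0 : i != ord0 by rewrite -(inj_eq val_inj) /= inordK //; lia.
have iN : i != ord_max by rewrite -(inj_eq val_inj) /= inordK //; lia.
have := zariski_lie_bracket (zariski_lie_delta_0i i0 iN) (zariski_lie_delta_iN i0 iN).
by rewrite bracket_delta eqxx (max_neq0 N0) scale1r scale0r subr0.
Qed.

Lemma zariski_lie_delta i j : i != j -> L (e i j).
Proof.
move=> ij; have L0 k : k != ord0 -> L (e ord0 k).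
  move=> k0; have [->|kN] := eqVneq k ord_max; first exact: zariski_lie_delta_0N.
  exact: zariski_lie_delta_0i.
have [j0|j0] := eqVneq j ord0; first by rewrite j0 in ij *; apply: zariski_lie_delta_i0.
have [i0|i0] := eqVneq i ord0; first by rewrite i0; apply: L0.
have := zariski_lie_bracket (zariski_lie_delta_i0 i0) (L0 j j0).
by rewrite bracket_delta eqxx [j == i]eq_sym (negbTE ij) scale1r scale0r subr0.
Qed.

Lemma zariski_lie_sl (X : 'M[K]_N.+1) : \tr X = 0 -> L X.
Proof.
move=> trX.
have Lh i : L (e i i - e ord0 ord0).
  have [->|i0] := eqVneq i ord0; first by rewrite subrr; exact: zariski_lie0.
  have := zariski_lie_bracket (zariski_lie_delta i0) (zariski_lie_delta _).
  move=> /(_ ord0 i); rewrite bracket_delta !eqxx !scale1r eq_sym; exact.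
(* The multiples of e_{0,0} subtracted here add up to the trace of X, which is zero. *)
have -> : X = \sum_i (X i i *: (e i i - e ord0 ord0) +
                      \sum_(j | j != i) X i j *: e i j).
  under eq_bigr do rewrite scalerBr addrAC -[X in X - _](bigD1 _ (isT : predT _)).
  rewrite sumrB -scaler_suml -/(mxtrace X) trX scale0r subr0.
  exact: matrix_sum_delta.
apply: zariski_lie_sum => i _; apply: zariski_lieD; first exact: zariski_lieZ.
apply: zariski_lie_sum => j ji; apply: zariski_lieZ; apply: zariski_lie_delta.
by rewrite eq_sym.
Qed.


End EvenN.

End LieAlgebraOfThePair.
(** * Generation by transvections *)

Section SpecialLinearGeneration.
Variables (K : fieldType) (N : nat).
Implicit Types (g : 'M[K]_N.+1) (f : 'cV[K]_N.+1) (u : 'rV[K]_N.+1).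

Lemma det_transvection f u : u *m f = 0 -> \det (1 + f *m u) = 1.
Proof.
move=> uf.
(* Two triangular factorizations of the matrix with blocks 1 + f u, f, u and 1; they agree because u
   f = 0. *)
have : block_mx 1%:M 0 u (1%:M : 'M_1) *m block_mx (1 + f *m u) f 0 1%:M
       = block_mx 1%:M f 0 1%:M *m block_mx 1%:M 0 u 1%:M.
  rewrite !mulmx_block !(mul1mx, mulmx1, mul0mx, mulmx0, addr0, add0r).
  by rewrite mulmxDr mulmx1 mulmxA uf mul0mx addr0 add0r.
move/(congr1 determinant); rewrite !det_mulmx !det_lblock !det_ublock !det1.
by rewrite !(mul1r, mulr1).
Qed.

Lemma mul_transvectionN f u :
  u *m f = 0 -> (1 + f *m u) *m (1 - f *m u) = 1.
Proof.
move=> uf; rewrite mulmxBr mulmx1 mulmxDl mul1mx.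
have -> : f *m u *m (f *m u) = 0 by rewrite mulmxA -(mulmxA f) uf mulmx0 mul0mx.
by rewrite addr0 addrK.
Qed.

Variable Z : set 'M[K]_N.+1.
Hypothesis Z1 : Z 1.
Hypothesis ZM : forall g f u, u *m f = 0 -> Z g -> Z (g *m (1 + f *m u)).

(** The inverse of a transvection is a transvection, so g may be reduced to 1 rather than built up
    from 1. *)
Lemma transvection_closedV g f u :
  u *m f = 0 -> Z (g *m (1 + f *m u)) -> Z g.
Proof.
move=> uf Zg; have ufN : u *m (- f) = 0 by rewrite mulmxN uf oppr0.
by have := ZM ufN Zg; rewrite mulNmx -mulmxA mul_transvectionN // mulmx1.
Qed.

(* Right multiplication by 1 + f (e_k - e_k g) sends the row e_k g to e_k when
   e_k f = e_k g f = 1, and fixes e_i for i < k when f is supported on [k, N]. *)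
Lemma transvection_step (k : 'I_N.+1) g f :
    (forall i : 'I_N.+1, (i < k)%N -> row i g = row i 1) ->
    (forall i : 'I_N.+1, (i < k)%N -> f i 0 = 0) ->
    f k 0 = 1 -> (row k g *m f) 0 0 = 1 ->
  exists2 u, u *m f = 0 &
    forall i : 'I_N.+1, (i <= k)%N -> row i (g *m (1 + f *m u)) = row i 1.
Proof.
move=> gk f0 fk gf; exists (row k 1 - row k g).
  apply/matrixP => i j; rewrite !ord1 mulmxBl [LHS]mxE [X in _ + X]mxE gf.
  by rewrite -row_mul mul1mx !mxE fk subrr.
move=> i ik; set u := row k 1 - _; rewrite row_mul mulmxDr mulmx1 mulmxA.
have -> : row i g *m f = (i == k)%:R.
  apply/matrixP => a b; rewrite !ord1; have [->|ik'] := eqVneq i k.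
    by rewrite gf mxE eqxx.
  have {}ik : (i < k)%N by rewrite ltn_neqAle ik'.
  by rewrite gk // -row_mul mul1mx !mxE f0.
have [->|ik'] := eqVneq i k; first by rewrite mul1mx /u addrC subrK.
by rewrite mul0mx addr0 gk // ltn_neqAle ik'.
Qed.

(** Right multiplications by transvections turn the rows of g into those of 1 from the top down; d
    bounds the number of rows still to be treated. *)
Lemma special_linear_ind g : \det g = 1 -> Z g.
Proof.
suff main d h : \det h = 1 ->
    (forall i : 'I_N.+1, (i + d < N.+1)%N -> row i h = row i 1) -> Z h.
  by move=> g1; apply: (main N.+1) => // i; lia.
elim: d h => [|d IHd] h h1 hd.
  suff -> : h = 1 by [].
  by apply/row_matrixP => i; apply: hd; rewrite addn0.
have [dN|Nd] := ltnP N d; first by apply: IHd => // i id; lia.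
pose k : 'I_N.+1 := inord (N - d).
have kE : k = (N - d)%N :> nat by rewrite inordK //; lia.
have hk (i : 'I_N.+1) : (i < k)%N -> row i h = row i 1 by move=> ik; apply: hd; lia.
have step h' f : \det h' = 1 ->
    (forall i : 'I_N.+1, (i < k)%N -> row i h' = row i 1) ->
    (forall i : 'I_N.+1, (i < k)%N -> f i 0 = 0) ->
    f k 0 = 1 -> (row k h' *m f) 0 0 = 1 -> Z h'.
  move=> h'1 h'k f0 fk hf; have [u uf gu] := transvection_step h'k f0 fk hf.
  apply: (transvection_closedV uf); apply: IHd.
    by rewrite det_mulmx h'1 det_transvection // mulr1.
  by move=> i id; apply: gu; lia.
(* If row k has a nonzero entry to the right of the diagonal, a multiple of e_j added to e_k
   corrects the product of row k with f to 1. *)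
have stepj h' (j : 'I_N.+1) : \det h' = 1 ->
    (forall i : 'I_N.+1, (i < k)%N -> row i h' = row i 1) ->
    (k < j)%N -> h' k j != 0 -> Z h'.
  move=> h'1 h'k kj hkj.
  apply: (step _ (delta_mx k 0 + ((1 - h' k k) / h' k j) *: delta_mx j 0)) => //.
  - move=> i ik; rewrite !mxE -!(inj_eq val_inj) /= (ltn_eqF ik).
    by rewrite (ltn_eqF (ltn_trans ik kj)) mulr0 addr0.
  - by rewrite !mxE -!(inj_eq val_inj) /= eqxx (ltn_eqF kj) mulr0 addr0.
  - rewrite mulmxDr -scalemxAr -!colE. rewrite !mxE divfK //; ring.
have [/existsP[j /andP[kj hkj]]|] :=
  boolP [exists j : 'I_N.+1, (k < j)%N && (h k j != 0)].
  exact: (stepj h j).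
rewrite negb_exists => /forallP hkj.
have hk0 (j : 'I_N.+1) : (k < j)%N -> h k j = 0.
  by move=> kj; have := hkj j; rewrite kj negbK => /eqP.
have [hkk|hkk] := eqVneq (h k k) 1.
  apply: (step _ (delta_mx k 0)) => //.
  - by move=> i ik; rewrite mxE -(inj_eq val_inj) /= (ltn_eqF ik).
  - by rewrite mxE !eqxx.
  - by rewrite -colE !mxE.
have h_unit : h \in unitmx by rewrite unitmxE h1 unitr1.
(* Otherwise row k would be a combination of the rows above it, which are standard; v records this
   relation. *)
have hkk0 : h k k != 0.
  apply/eqP => hkk0.
  pose v : 'rV_N.+1 := row k 1 - \row_j (if (j < k)%N then h k j else 0).
  have vh : v *m h = 0.
    apply/matrixP => a l; rewrite mulmxBl -row_mul mul1mx !mxE; apply/eqP.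
    rewrite subr_eq0; apply/eqP; rewrite (bigID (fun j : 'I_N.+1 => (j < k)%N)) /=.
    rewrite [X in _ + X]big1 ?addr0; last by move=> j /negbTE jk; rewrite mxE jk mul0r.
    have hE (j : 'I_N.+1) : (j < k)%N -> h j l = (j == l)%:R.
      by move=> /hk /rowP /(_ l); rewrite !mxE.
    under eq_bigr => j jk do rewrite mxE jk hE //.
    have [lk|kl] := ltnP l k.
      rewrite (bigD1 l) //= eqxx mulr1 big1 ?addr0 // => j /andP[_ /negbTE ->].
      by rewrite mulr0.
    rewrite big1 => [|j jk].
      move: kl; rewrite leq_eqVlt => /predU1P[kl|/hk0 //].
      by rewrite -(val_inj kl).
    by rewrite -(inj_eq val_inj) /= ltn_eqF ?mulr0 // (leq_trans jk).
  have : v = 0 by rewrite -[v](mulmxK h_unit) vh mul0mx.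
  move=> /matrixP /(_ 0 k); rewrite !mxE eqxx ltnn subr0.
  by move/eqP; rewrite oner_eq0.
(* In the last row h is triangular, so its determinant 1 is the entry h k k, which was assumed
   different from 1. *)
have [d0|d0] := posnP d.
  have kN : k = N :> nat by rewrite kE d0 subn0.
  case/eqP: hkk; rewrite -h1 det_trig.
    rewrite (bigD1 k) //= big1 ?mulr1 // => i ik.
    have /hk /rowP /(_ i) : (i < k)%N.
      by rewrite ltn_neqAle (inj_eq val_inj) ik kN leq_ord.
    by rewrite !mxE eqxx.
  apply/is_trig_mxP => i j ij; have /hk /rowP /(_ j) : (i < k)%N.
    by rewrite kN (leq_trans ij) ?leq_ord.
  by rewrite !mxE => ->; rewrite -(inj_eq val_inj) /= ltn_eqF.
(* Adding column k to column k + 1 puts h k k, which is nonzero, to the right of the diagonal and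
   brings back the case of [stepj]. *)
have k1N : (k.+1 < N.+1)%N by lia.
pose j := Ordinal k1N.
have kj : (k < j)%N by [].
have uf : delta_mx 0 j *m delta_mx k 0 = 0 :> 'M[K]_1.
  by rewrite mul_delta_mx_cond -(inj_eq val_inj) /= gtn_eqF.
apply: (transvection_closedV uf); apply: (stepj _ j) => //.
- by rewrite det_mulmx h1 det_transvection ?mulr1.
- move=> i ik; rewrite row_mul mulmxDr mulmx1 mulmxA hk // -row_mul mul1mx.
  suff -> : row i (delta_mx k 0 : 'cV[K]_N.+1) = 0 by rewrite mul0mx addr0.
  by apply/rowP => a; rewrite !mxE -(inj_eq val_inj) /= ltn_eqF.
- rewrite mulmxDr mulmx1 mulmxA -colE mxE hk0 // add0r mxE big_ord1 !mxE.
  by rewrite !eqxx mulr1.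
Qed.

End SpecialLinearGeneration.

(** * Symplectic transvections *)

Section SymplecticGeneration.
Variables (K : numFieldType) (N : nat).
Hypothesis N_odd : odd N.
Implicit Types (g : 'M[K]_N.+1) (u v w : 'rV[K]_N.+1) (c : K).
Local Notation J := (Jmx K N).

Lemma JmxE i j : J i j = (-1) ^+ i.+1 * (j == rev_ord i)%:R.
Proof.
rewrite /Jmx summxE (bigD1 i) //= big1 ?addr0 => [|k ki]; first by rewrite !mxE eqxx.
by rewrite !mxE [i == k]eq_sym (negbTE ki) mulr0.
Qed.

Lemma mul_Jmx (m : nat) (A : 'M[K]_(m, N.+1)) i j :
  (A *m J) i j = (-1) ^+ (rev_ord j).+1 * A i (rev_ord j).
Proof.
rewrite mxE (bigD1 (rev_ord j)) //= big1 ?addr0 => [|k kj].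
  by rewrite JmxE rev_ordK eqxx mulr1 mulrC.
rewrite JmxE -(inj_eq rev_ord_inj) rev_ordK [_ == k]eq_sym (negbTE kj).
by rewrite !mulr0.
Qed.

Lemma Jmx_mul (m : nat) (A : 'M[K]_(N.+1, m)) i j :
  (J *m A) i j = (-1) ^+ i.+1 * A (rev_ord i) j.
Proof.
rewrite mxE (bigD1 (rev_ord i)) //= big1 ?addr0 => [|k ki].
  by rewrite JmxE eqxx mulr1.
by rewrite JmxE (negbTE ki) mulr0 mul0r.
Qed.

Lemma signr_rev_ord (i : 'I_N.+1) : (-1) ^+ (rev_ord i).+1 = (-1) ^+ i :> K.
Proof.
rewrite -signr_odd -[RHS]signr_odd /= subSS; congr (_ ^+ (nat_of_bool _)).
have := leq_ord i; lia.
Qed.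

Lemma tr_Jmx : J^T = - J.
Proof.
apply/matrixP => i j; rewrite !mxE !JmxE -(inj_eq rev_ord_inj) rev_ordK [_ == j]eq_sym.
case: eqP => [->|_]; last by rewrite !mulr0 oppr0.
by rewrite signr_rev_ord exprS !mulr1 mulN1r opprK.
Qed.

Lemma mul_Jmx_Jmx : J *m J = - 1.
Proof.
apply/matrixP => i j; rewrite Jmx_mul JmxE rev_ordK signr_rev_ord mulrA.
by rewrite -exprD addSn addnn exprS -signr_odd odd_double mulr1 !mxE eq_sym mulN1r.
Qed.

(** Rows are used because g J g^T = J says that right multiplication by g preserves this form. *)
Definition sform u w : K := (u *m J *m w^T) 0 0.

Lemma sformDl u v w : sform (u + v) w = sform u w + sform v w.
Proof. by rewrite /sform !mulmxDl mxE. Qed.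

Lemma sformBl u v w : sform (u - v) w = sform u w - sform v w.
Proof. by rewrite /sform !mulmxBl !mxE. Qed.

Lemma sformZl c u w : sform (c *: u) w = c * sform u w.
Proof. by rewrite /sform -!scalemxAl mxE. Qed.

Lemma sformC u w : sform w u = - sform u w.
Proof.
have : (w *m J *m u^T)^T = - (u *m J *m w^T).
  by rewrite !trmx_mul trmxK tr_Jmx mulNmx mulmxN mulmxA.
by move/matrixP/(_ 0 0); rewrite [X in X = _ -> _]mxE [X in _ = X -> _]mxE.
Qed.

Lemma sform_id u : sform u u = 0.
Proof.
have /eqP := sformC u u; rewrite -addr_eq0 -mulr2n mulrn_eq0 /=.
by move/eqP.
Qed.

Lemma sform_nondeg u : u != 0 -> J *m u^T != 0.
Proof.
apply: contra_neq => Ju; apply: trmx_inj; rewrite trmx0 -[u^T]mul1mx.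
by rewrite -[1%:M]opprK -[- 1%:M]mul_Jmx_Jmx mulNmx -mulmxA Ju mulmx0 oppr0.
Qed.

Definition sptrans c v : 'M[K]_N.+1 := 1 + c *: (J *m v^T *m v).

Lemma mx11_sform u w : u *m J *m w^T = (sform u w)%:M.
Proof. exact: mx11_scalar. Qed.

Lemma mul_sptrans u c v : u *m sptrans c v = u + (c * sform u v) *: v.
Proof.
rewrite mulmxDr mulmx1 -scalemxAr !mulmxA mx11_sform mul_scalar_mx.
by rewrite scalerA.
Qed.

Lemma sptrans_sq v : J *m v^T *m v *m (J *m v^T *m v) = 0.
Proof.
rewrite -!mulmxA (mulmxA v J) (mulmxA (v *m J)) mx11_sform sform_id.
by rewrite mul_scalar_mx scale0r !mulmx0.
Qed.

Lemma sptransN c v : sptrans c v *m sptrans (- c) v = 1.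
Proof.
rewrite mulmxDl mul1mx mulmxDr mulmx1 -scalemxAl -scalemxAr sptrans_sq !scaler0.
by rewrite addr0 /sptrans scaleNr subrK.
Qed.

(** The first hypothesis cancels the terms linear in c; it also turns X J X^T into - X^2 J, which is
    zero. *)
Lemma sp_unipotent (X : 'M[K]_N.+1) c :
  X *m J + J *m X^T = 0 -> X *m X = 0 -> Spn K N (1 + c *: X).
Proof.
move=> XJ XX; split.
  apply/unitrP; exists (1 - c *: X); split; apply/eqP.
    rewrite mulrBl mul1r mulrDr mulr1 -scalerAl -scalerAr [X * X]XX !scaler0.
    by rewrite addr0 addrK.
  rewrite mulrDl mul1r mulrBr mulr1 -scalerAl -scalerAr [X * X]XX !scaler0.
  by rewrite subr0 subrK.
have JX : J *m X^T = - (X *m J) by apply/eqP; rewrite -addr_eq0 addrC XJ.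
rewrite linearD /= linearZ /= trmx1 mulmxDr mulmx1 !mulmxDl !mul1mx.
rewrite -!scalemxAr -!scalemxAl -mulmxA JX mulmxN mulmxA XX mul0mx oppr0 !scaler0.
by rewrite addr0 scalerN -addrA subrr addr0.
Qed.

Lemma sptrans_sp c v : Spn K N (sptrans c v).
Proof.
apply: sp_unipotent; last exact: sptrans_sq.
by rewrite !trmx_mul trmxK tr_Jmx !mulmxN !mulmxA subrr.
Qed.

Lemma row_nz_dotP (f : 'cV[K]_N.+1) : f != 0 -> exists u, u *m f != 0.
Proof.
move=> /cV0Pn [i fi]; exists (delta_mx 0 i); rewrite -rowE.
by apply: contra_neq fi => /rowP /(_ 0); rewrite !mxE.
Qed.

(** Two hyperplanes do not cover the space. *)
Lemma row_nz_dotP2 (f1 f2 : 'cV[K]_N.+1) :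
  f1 != 0 -> f2 != 0 -> exists u, u *m f1 != 0 /\ u *m f2 != 0.
Proof.
move=> /row_nz_dotP [u1 u1f] /row_nz_dotP [u2 u2f].
have [u1f2|u1f2] := eqVneq (u1 *m f2) 0; last by exists u1.
have [u2f1|u2f1] := eqVneq (u2 *m f1) 0; last by exists u2.
by exists (u1 + u2); rewrite !mulmxDl u1f2 u2f1 addr0 add0r.
Qed.

Lemma rank_lt_ker (A B : 'M[K]_N.+1) v :
  kermx A *m B = 0 -> v *m B = 0 -> v *m A != 0 -> (\rank B < \rank A)%N.
Proof.
move=> AB vB vA.
have : (kermx A < kermx B)%MS.
  rewrite /ltmx; apply/andP; split; first exact/sub_kermxP.
  apply: contra vA => BA; apply/eqP/sub_kermxP.
  by apply: submx_trans BA; apply/sub_kermxP.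
move/rank_ltmx; rewrite !mxrank_ker.
have := rank_leq_row A; have := rank_leq_row B; lia.
Qed.

Lemma rank_le_ker (A B : 'M[K]_N.+1) :
  kermx A *m B = 0 -> (\rank B <= \rank A)%N.
Proof.
move=> /sub_kermxP /mxrankS; rewrite !mxrank_ker.
have := rank_leq_row A; have := rank_leq_row B; lia.
Qed.

(* The fixed space of g is orthogonal to the image of g - 1, so a transvection
   along v g - v keeps it fixed. *)
Lemma ker_mul_sptrans g x c : Spn K N g ->
  kermx (g - 1) *m (g *m sptrans c (x *m g - x) - 1) = 0.
Proof.
move=> [_ gJ]; set k := kermx _.
have kg : k *m g = k.
  by apply/eqP; rewrite -subr_eq0 -{2}[k]mulmx1 -mulmxBr mulmx_ker.
rewrite mulmxBr mulmx1 mulmxA kg mulmxDr mulmx1 -scalemxAr !mulmxA.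
suff -> : k *m J *m (x *m g - x)^T = 0 by rewrite mul0mx scaler0 addr0 subrr.
have kgJ : k *m J *m g^T = k *m J by rewrite -{1}kg -!mulmxA (mulmxA g) gJ.
by rewrite linearB /= trmx_mul mulmxBr !mulmxA kgJ subrr.
Qed.

Variable Z : set 'M[K]_N.+1.
Hypothesis Z1 : Z 1.
Hypothesis ZM : forall g c v, Z g -> Z (g *m sptrans c v).

Lemma sptrans_closedV g c v : Z (g *m sptrans c v) -> Z g.
Proof. by move=> /(ZM (- c) v); rewrite -mulmxA sptransN mulmx1. Qed.

(** Induction on the rank of g - 1: a suitable transvection enlarges the space of fixed rows. *)
Lemma symplectic_ind g : Spn K N g -> Z g.
Proof.
have [n] := ubnP (\rank (g - 1)%R); elim: n g => // n IHn g; rewrite ltnS => rg gS.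
(* The transvection along u = v h - v with this coefficient sends v h back to v, so v becomes a new
   fixed row. *)
have step (h : 'M[K]_N.+1) v :
    (\rank (h - 1)%R <= n)%N -> Spn K N h -> sform v (v *m h) != 0 -> Z h.
  move=> rh hS vh; pose u := v *m h - v.
  apply: (@sptrans_closedV _ (- (sform v (v *m h))^-1) u).
  apply: IHn; last exact/SpnM/sptrans_sp.
  have u0 : u != 0.
    apply: contra_neq vh => /eqP; rewrite subr_eq0 => /eqP ->; exact: sform_id.
  apply: leq_trans rh; apply: (rank_lt_ker (v := v)).
  - exact: ker_mul_sptrans.
  - rewrite mulmxBr mulmx1 mulmxA mul_sptrans [sform _ u]sformC sformBl sform_id.
    by rewrite sub0r opprK mulNr mulVf // scaleN1r /u opprB addrCA subrr addr0 subrr.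
  - by rewrite mulmxBr mulmx1.
have [->//|g1] := eqVneq g 1.
have [x ug0] : exists x : 'rV_N.+1, x *m g - x != 0.
  move: g1; rewrite -subr_eq0 => /matrix0Pn [i [j gij]]; exists (row i 1).
  by apply: contra_neq gij => /rowP /(_ j); rewrite -row_mul mul1mx !mxE.
pose u := x *m g - x; have u0 : u != 0 := ug0.
have gu0 : g *m (J *m u^T) != 0.
  apply: contra_neq (sform_nondeg u0) => gu.
  by rewrite -[LHS](mulKmx (proj1 gS)) gu mulmx0.
(* Neither v g nor v is orthogonal to u. If v g is orthogonal to v, a first transvection along u
   destroys this orthogonality without raising the rank. *)
have [v [vf1 vf2]] := row_nz_dotP2 gu0 (sform_nondeg u0).
have [vg|] := eqVneq (sform v (v *m g)) 0; last exact: step.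
apply: (@sptrans_closedV _ 1 u); apply: (step _ v).
- by apply: leq_trans rg; apply/rank_le_ker/ker_mul_sptrans.
- exact/SpnM/sptrans_sp.
rewrite mulmxA mul_sptrans mul1r sformC sformDl sformZl sformC vg oppr0 add0r oppr_eq0.
rewrite mulf_neq0 //.
  by apply: contra_neq vf1 => vu; rewrite !mulmxA mx11_sform vu raddf0.
by apply: contra_neq vf2 => vu; rewrite mulmxA mx11_sform sformC vu oppr0 raddf0.
Qed.

End SymplecticGeneration.

(** * Zariski density *)

Section Density.
Variables (K : numFieldType) (N : nat) (H : set 'M[K]_N.+1) (t s : K).
Hypotheses (H_group : is_subgroup H) (t0 : t != 0) (s0 : s != 0).
Hypotheses (Ha : H (amx N t)) (Hb : H (bmx N s)).

Lemma zariski_closure1 : zariski_closure H 1.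
Proof. by move=> Z [_ HZ]; apply: HZ; case: H_group. Qed.

Lemma zariski_dense_SLn :
  ~~ odd N -> (1 < N)%N -> H `<=` SLn K N -> zariski_dense H (SLn K N).
Proof.
move=> N_even N1 HG; split=> //; apply/seteqP; split=> [g []//|g g1]; split=> //.
apply: special_linear_ind g1; first exact: zariski_closure1.
move=> h f u uf Zh; rewrite -[f *m u]scale1r.
apply: zariski_closure_unipotent Zh.
  apply: (zariski_lie_sl (ltnW N1) H_group t0 s0 Ha Hb) => //.
  by rewrite mxtrace_mulC uf mxtrace0.
by rewrite mulmxA -(mulmxA f) uf mulmx0 mul0mx.
Qed.

Lemma zariski_dense_Spn :
  odd N -> H `<=` Spn K N -> zariski_dense H (Spn K N).
Proof.
move=> N_odd HG; split=> //; apply/seteqP; split=> [g []//|g gS]; split=> //.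
apply: (symplectic_ind N_odd) gS; first exact: zariski_closure1.
move=> h c v Zh; apply: zariski_closure_unipotent Zh; last exact: sptrans_sq.
apply: (zariski_lie_sp (odd_gt0 N_odd) H_group t0 s0 Ha Hb) => i j.
set X := _ *m v.
have XJ : X *m Jmx K N + Jmx K N *m X^T = 0.
  by rewrite !trmx_mul trmxK tr_Jmx // !mulmxN !mulmxA subrr.
(* This entry of the relation is, up to signs, the symmetry between (i, j) and (rev j, rev i)
   required by [zariski_lie_sp]. *)
have /matrixP /(_ i (rev_ord j)) := XJ.
rewrite mxE mul_Jmx Jmx_mul rev_ordK [X^T _ _]mxE [RHS]mxE => /eqP.
rewrite addr_eq0 !exprS !mulN1r !mulNr eqr_opp => /eqP XE.
by rewrite exprD [_ * (-1) ^+ j]mulrC -mulrA -mulrN -XE mulrA -expr2 sqrr_sign mul1r.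
Qed.

End Density.

(** * Ping-pong *)

Section PingPong.
Variables (K : fieldType) (N : nat) (a b : 'M[K]_N.+1) (U V : set 'cV[K]_N.+1).
Hypotheses (a_unit : a \is a GRing.unit) (b_unit : b \is a GRing.unit).
Hypothesis aVU : forall (k : int) v, k != 0 -> V v -> U (a ^ k *m v).
Hypothesis bUV : forall (k : int) v, k != 0 -> U v -> V (b ^ k *m v).

(** Alternating words that begin and end with a nonzero power of b; these send U into V. *)
Inductive b_word : 'M[K]_N.+1 -> Prop :=
| BWordPow l : l != 0 -> b_word (b ^ l)
| BWordCons l k w : l != 0 -> k != 0 -> b_word w -> b_word (b ^ l * (a ^ k * w)).

Definition normal_word (g : 'M[K]_N.+1) : Prop :=
  exists i : int, g = a ^ i \/
    exists j w, b_word w /\ g = a ^ i * (w * a ^ j).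

Lemma b_word_ping w v : b_word w -> U v -> V (w *m v).
Proof.
move=> ww Uv; elim: ww => [l l0|l k {}w l0 k0 _ Vw]; first exact: bUV.
by rewrite -!mulmxA; apply: bUV => //; apply: aVU.
Qed.

Lemma normal_word_a k g : normal_word g -> normal_word (a ^ k * g).
Proof.
move=> [i gE]; exists (k + i).
case: gE => [->|[j [w [ww ->]]]]; first by left; rewrite exprzDr.
by right; exists j, w; split=> //; rewrite mulrA -exprzDr.
Qed.

Lemma normal_word_b l g : normal_word g -> normal_word (b ^ l * g).
Proof.
have [-> ng|l0] := eqVneq l 0; first by rewrite expr0z mul1r.
move=> [i [->|[j [w [ww ->]]]]].
  exists 0; right; exists i, (b ^ l); split; first exact: BWordPow.
  by rewrite expr0z mul1r.
have [->|i0] := eqVneq i 0; last first.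
  exists 0; right; exists j, (b ^ l * (a ^ i * w)); split; first exact: BWordCons.
  by rewrite expr0z mul1r !mulrA.
(* With i = 0 the new power of b merges with the first power in w; if the two cancel, the power of a
   that follows becomes the outer one. *)
rewrite expr0z mul1r; case: ww => [m m0|m k {}w m0 k0 ww]; rewrite mulrA.
  rewrite -exprzDr //; have [->|lm] := eqVneq (l + m) 0.
    by exists j; left; rewrite expr0z mul1r.
  exists 0; right; exists j, (b ^ (l + m)); split; first exact: BWordPow.
  by rewrite expr0z mul1r.
rewrite !mulrA -exprzDr // -!mulrA; have [->|lm] := eqVneq (l + m) 0.
  by exists k; right; exists j, w; rewrite expr0z mul1r.
exists 0; right; exists j, (b ^ (l + m) * (a ^ k * w)); split; first exact: BWordCons.
by rewrite expr0z mul1r !mulrA.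
Qed.

Lemma generated_normal_word g : generated [set a; b] g -> normal_word g.
Proof.
(* The equivalence, rather than one implication, makes this set closed under inverses. *)
pose G : set 'M[K]_N.+1 := [set g | g \is a GRing.unit /\
  forall h, normal_word h <-> normal_word (g * h)].
move=> Hg; suff [_ /(_ 1)] : G g.
  by rewrite mulr1 => -[+ _]; apply; exists 0; left; rewrite expr0z.
apply: Hg; split.
  split.
  - by move=> h [].
  - by split=> [|h]; [exact: unitr1 | rewrite mul1r].
  - move=> h h' [hu hn] [hu' hn']; split=> [|k]; first by rewrite unitrMl.
    by rewrite -mulrA -hn.
  - move=> h [hu hn]; split=> [|k]; first by rewrite unitrV.
    by rewrite [X in _ <-> X]hn mulVKr.
move=> _ [] ->; split=> // h; split=> nh.
- exact: (normal_word_a 1).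
- by rewrite -[h](mulKr a_unit); apply: (normal_word_a (-1)).
- exact: (normal_word_b 1).
- by rewrite -[h](mulKr b_unit); apply: (normal_word_b (-1)).
Qed.

(* If g = a^i w a^j with w a word from b to b, then w fixes v too, although it
   sends v from U into the disjoint set V. *)
Lemma ping_pong_stabilizer v g :
    U v -> ~ V v -> (forall i : int, a ^ i *m v = v) ->
    generated [set a; b] g -> g *m v = v ->
  exists i : int, g = a ^ i.
Proof.
move=> Uv nVv av /generated_normal_word [i [->|[j [w [ww ->]]]]] gv.
  by exists i.
case: nVv; suff <- : w *m v = v by apply: b_word_ping.
have aiu : a ^ i \in unitmx by rewrite -[_ \in _]/(_ \is a GRing.unit) unitrXz.
apply: (can_inj (mulKmx aiu)); rewrite av -[RHS]gv -[_ * (_ * _)]/(_ *m (_ *m _)).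
by rewrite -!mulmxA (av j).
Qed.

End PingPong.

(** * The sets X1 and X2 and the first basis vector *)

Section PingPongForThePair.
Variables (K : numFieldType) (N : nat).
Hypothesis N0 : (0 < N)%N.
Local Notation e0 := (delta_mx ord0 0 : 'cV[K]_N.+1).

Lemma bmx_mulE (c : K) (v : 'cV[K]_N.+1) i :
  (bmx N c *m v) i 0 = v i 0 + (i == ord_max)%:R * (c * v ord0 0).
Proof.
rewrite mulmxDl mul1mx mxE -scalemxAl; congr (_ + _).
rewrite mxE mxE (bigD1 ord0) //= big1 ?addr0 => [|j j0].
  by rewrite mxE eqxx andbT mulrCA.
by rewrite mxE (negbTE j0) andbF mul0r.
Qed.

(** The last coordinate becomes v_n + c v_1, of modulus at least |c| |v_1| - |v_n| > 2 |v_1| -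
    |v_1|. *)
Lemma bmx_ping (c : K) v : 2 < `|c| -> X1 K N v -> X2 K N (bmx N c *m v).
Proof.
move=> c2 v1 i iN; rewrite !bmx_mulE (negbTE iN) eqxx mul0r addr0 mul1r.
have vN : `|v ord_max 0| < `|v ord0 0|.
  by apply: v1; rewrite -(inj_eq val_inj) /= -lt0n.
have vi : `|v i 0| <= `|v ord0 0|.
  by have [->//|i0] := eqVneq i ord0; apply/ltW/v1.
apply: le_lt_trans vi _; rewrite addrC.
apply: lt_le_trans (lerB_normD _ _); rewrite normrM ltrBrDr.
apply: (@lt_trans _ _ (2 * `|v ord0 0|)).
  by rewrite mulr_natl mulr2n ltrD2l.
by rewrite ltr_pM2r // (le_lt_trans _ vN).
Qed.

Lemma amx_e0 (z : K) : amx N z *m e0 = e0.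
Proof.
rewrite -colE; apply/colP => i; rewrite mxE amxE !mxE leqn0 sub0n expcoef0 andbT.
by rewrite -(inj_eq val_inj) /=; case: (_ == _).
Qed.

Lemma X1_e0 : X1 K N e0.
Proof. by move=> i i0; rewrite !mxE eqxx (negbTE i0) normr0 normr1 ltr01. Qed.

Lemma X2_e0 : ~ X2 K N e0.
Proof.
move=> /(_ ord0); rewrite !mxE eqxx -!(inj_eq val_inj) /= (ltn_eqF N0) (gtn_eqF N0).
by rewrite normr0 normr1 ltr10 => /(_ isT).
Qed.

End PingPongForThePair.
(** * Thinness *)

Section Integrality.
Variables (K : numFieldType) (N : nat).

Lemma expcoef_int (k : int) d : (d <= N)%N ->
  exists e : int, expcoef ((N`!%:Z * k)%:~R : K) d = e%:~R.
Proof.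
case: d => [|d] dN; first by exists 1; rewrite expcoef0.
(* One of the factors N! absorbs the denominator: N! / (d+1)! = C(N, d+1) (N - d - 1)!. *)
exists ('C(N, d.+1)%:Z * (N - d.+1)`!%:Z * k * (N`!%:Z * k) ^+ d).
rewrite /expcoef exprS mulrAC !rmorphM rmorphXn /= rmorphM /=; congr (_ * _).
have := factr_neq0 K d.+1; rewrite -!pmulrn -(bin_fact dN).
by move: (d.+1`!) => f f0; rewrite !natrM; field.
Qed.

Lemma amx_int (k : int) : exists B : 'M[int]_N.+1,
  amx N ((N`!%:Z * k)%:~R : K) = map_mx intr B.
Proof.
have B_ex (i j : 'I_N.+1) : exists e : int, amx N ((N`!%:Z * k)%:~R : K) i j == e%:~R.
  rewrite amxE; case: leqP => ij; last by exists 0.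
  have [|e ->] := @expcoef_int k (j - i); last by exists e.
  by rewrite (leq_trans (leq_subr _ _)) ?leq_ord.
exists (\matrix_(i, j) xchoose (B_ex i j)).
apply/matrixP => i j; rewrite [RHS]mxE [X in _ = X%:~R]mxE.
exact/eqP/(xchooseP (B_ex i j)).
Qed.

Lemma bmx_int (s : int) : exists B : 'M[int]_N.+1,
  bmx N (s%:~R : K) = map_mx intr B.
Proof.
exists (1 + s *: delta_mx ord_max ord0).
by rewrite map_mxD map_mx1 map_mxZ map_delta_mx.
Qed.

Lemma det_amx (z : K) : \det (amx N z) = 1.
Proof.
rewrite -det_tr det_trig; last first.
  by apply/is_trig_mxP => i j ij; rewrite mxE amxE leqNgt ij.
by rewrite big1 // => i _; rewrite mxE amxE leqnn subnn expcoef0.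
Qed.

Lemma det_delta_unipotent (i j : 'I_N.+1) (c : K) :
  i != j -> \det (1 + c *: delta_mx i j) = 1.
Proof.
move=> ij; rewrite -(mul_delta_mx (0 : 'I_1)) scalemxAl det_transvection //.
by rewrite -scalemxAr mul_delta_mx_cond eq_sym (negbTE ij) mulr0n scaler0.
Qed.

Lemma amx_sp (z : K) : odd N -> Spn K N (amx N z).
Proof.
move=> N_odd; split; first exact: amx_unit.
(* J carries the transpose to a signed reflection in the antidiagonal, under which a(z) becomes its
   inverse. *)
suff -> : amx N z *m Jmx K N = Jmx K N *m (amx N (- z))^T.
  by rewrite -mulmxA -trmx_mul amxVr trmx1 mulmx1.
apply/matrixP => i j; rewrite mul_Jmx Jmx_mul // [_^T _ _]mxE !amxE.
rewrite signr_rev_ord //= !subSS; have := leq_ord i; have := leq_ord j => jN iN.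
have -> : (j <= N - i)%N = (i <= N - j)%N by lia.
case: ifP => [ij|_]; last by rewrite !mulr0.
have -> : (N - i - j = N - j - i)%N by lia.
rewrite expcoefN mulrA -exprD; congr (_ * _).
rewrite -signr_odd -[RHS]signr_odd; congr (_ ^+ (nat_of_bool _)); lia.
Qed.

(** The product of e_{i, rev i} with J is diagonal, hence symmetric. The case [ord_max] gives b(s),
    the case [ord0] the coset representatives. *)
Lemma corner_sp (c : K) (i : 'I_N.+1) :
  odd N -> Spn K N (1 + c *: delta_mx i (rev_ord i)).
Proof.
move=> N_odd; have ii : (rev_ord i == i) = false.
  by rewrite -(inj_eq val_inj) /=; have := leq_ord i; lia.
apply: sp_unipotent; last by rewrite mul_delta_mx_cond ii mulr0n.
  apply/matrixP => k l; rewrite mxE mul_Jmx // Jmx_mul // trmx_delta !mxE.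
rewrite !(inj_eq rev_ord_inj) andbC.
case: eqP => [->|_] /=; last by rewrite !mulr0 addr0.
case: eqP => [->|_] /=; last by rewrite !mulr0 addr0.
by rewrite signr_rev_ord // exprS !mulr1 mulN1r subrr.
Qed.

End Integrality.

(** * Integrality, density and infinite index of H *)

Section Thin.
Variables (K : numFieldType) (N : nat) (t s k : int).
Local Notation a := (amx N (t%:~R : K)).
Local Notation b := (bmx N (s%:~R : K)).
Local Notation H := (Hgrp N (t%:~R : K) s%:~R).
Hypotheses (N1 : (1 < N)%N) (tE : t = N`!%:Z * k) (hs : 2 < `|s|).
Hypothesis a_ping : forall (l : int) v, l != 0 -> X2 K N v -> X1 K N (a ^ l *m v).

Let N0 : (0 < N)%N := ltnW N1.

(** For t = 0 the matrix a would be 1 and X2 would lie in X1, but the last basis vector is in X2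
    only. *)
Lemma ping_t_neq0 : t%:~R != 0 :> K.
Proof.
apply/eqP => t0.
have eN : X2 K N (delta_mx ord_max 0).
  by move=> i iN; rewrite !mxE !eqxx (negbTE iN) normr0 normr1 ltr01.
have := @a_ping 1 _ isT eN; rewrite t0 amx0 expr1z mul1mx => /(_ ord_max).
rewrite max_neq0 // !mxE eqxx andbT [ord0 == _]eq_sym max_neq0 //.
by rewrite normr0 normr1 ltr10 => /(_ isT).
Qed.

Lemma ping_s_neq0 : s%:~R != 0 :> K.
Proof. by rewrite intr_eq0; apply: contraTneq hs => ->. Qed.

Lemma Hgrp_gens_unit : [set a; b] `<=` [set g | g \is a GRing.unit].
Proof. by move=> _ [] ->; [exact: amx_unit | exact: bmx_unit]. Qed.

Lemma Hgrp_is_subgroup : is_subgroup H.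
Proof. exact: generated_is_subgroup Hgrp_gens_unit. Qed.

Lemma Hgrp_integer_points G :
  is_subgroup G -> G a -> G b -> H `<=` integer_points G.
Proof.
move=> sG Ga Gb; suff HG : H `<=` integral_units G.
  by move=> g /HG [Gg [B [_ [gB _]]]]; split=> //; exists B.
apply: generated_min; first exact: integral_units_is_subgroup.
move=> _ [] ->; split=> //.
  have [B aB] := amx_int K N k; have [C aC] := amx_int K N (- k).
  by exists B, C; rewrite -aB -aC tE amxV mulrN rmorphN.
have [B bB] := bmx_int K N s; have [C bC] := bmx_int K N (- s).
by exists B, C; rewrite -bB -bC bmxV // rmorphN.
Qed.

(** The powers of 1 + e_{1,n}, which will represent pairwise distinct cosets of H. *)
Definition corner (l : nat) : 'M[K]_N.+1 := 1 + l%:R *: delta_mx ord0 ord_max.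

Lemma ord0_neq_max : (ord0 == ord_max :> 'I_N.+1) = false.
Proof. by rewrite eq_sym max_neq0. Qed.

Lemma corner_mul (c d : K) :
  (1 + c *: delta_mx ord0 ord_max) * (1 + d *: delta_mx ord0 ord_max) =
  1 + (c + d) *: delta_mx ord0 ord_max :> 'M[K]_N.+1.
Proof.
rewrite mulrDl mul1r mulrDr mulr1 -scalerAl -scalerAr.
rewrite [delta_mx _ _ * _]mul_delta_mx_cond max_neq0 // mulr0n !scaler0 addr0.
by rewrite -addrA [d *: _ + _]addrC -scalerDl.
Qed.

Lemma corner_unit l : corner l \is a GRing.unit.
Proof.
by apply/unitrP; exists (1 + (- l%:R) *: delta_mx ord0 ord_max);
   rewrite !corner_mul addNr subrr scale0r addr0.
Qed.

Lemma corner_inv l : (corner l)^-1 = 1 + (- l%:R) *: delta_mx ord0 ord_max.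
Proof.
apply: (mulrI (corner_unit l)); rewrite divrr ?corner_unit // corner_mul.
by rewrite subrr scale0r addr0.
Qed.

Lemma bXz_ping (l : int) v : l != 0 -> X1 K N v -> X2 K N (b ^ l *m v).
Proof.
move=> l0; rewrite bmxXz //; apply: bmx_ping => //.
rewrite -rmorphM -intr_norm.
(* A nonzero integer l has |l| >= 1, so |l s| >= |s|. *)
have : 2 < `|l * s| by nia.
by rewrite -(ltr_int K).
Qed.

(* A power of the unipotent 1 + e_{1,n} that lies in H fixes e_1, hence is a
   power of a(t); but the (1,2) entry of a(t)^i is i t. *)
Lemma corner_Hgrp (c : K) : H (1 + c *: delta_mx ord0 ord_max) -> c = 0.
Proof.
move=> Hc.
have [||i cE] := ping_pong_stabilizer (amx_unit _ _) (bmx_unit _ N0) a_ping bXz_ping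
  (@X1_e0 K N) (X2_e0 N0) _ Hc.
- by move=> l; rewrite amxXz amx_e0.
- rewrite mulmxDl mul1mx -scalemxAl mul_delta_mx_cond max_neq0 //.
  by rewrite mulr0n scaler0 addr0.
(* Since 1 < N, the column of index 1 is not the last one, so the entry of 1 + c e_{1,n} there is 0
   and i t = 0. *)
have i1 : (1 < N.+1)%N by [].
move/matrixP: cE; rewrite amxXz => cE.
have /eqP := cE ord0 (Ordinal i1).
rewrite amxE !mxE -!(inj_eq val_inj) /= (ltn_eqF N1) mulr0 addr0 /expcoef expr1 divr1.
rewrite eq_sym mulf_eq0 (negbTE ping_t_neq0) orbF intr_eq0 => /eqP i0.
have := cE ord0 ord_max; rewrite i0 mul0r amx0 !mxE !eqxx ord0_neq_max add0r mulr1.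
exact: id.
Qed.

Lemma infinite_index_Hgrp G :
  (forall l, G (corner l)) -> infinite_index H (integer_points G).
Proof.
move=> Gc; apply: (infinite_index_seq (f := corner) Hgrp_is_subgroup).
- move=> l; split=> //; exists (1 + l%:Z *: delta_mx ord0 ord_max).
  by rewrite map_mxD map_mx1 map_mxZ map_delta_mx.
- exact: corner_unit.
- move=> l m; rewrite corner_inv corner_mul => /corner_Hgrp /eqP.
  by rewrite addrC subr_eq0 eqr_nat => /eqP.
Qed.

Lemma Hgrp_amx : H a. Proof. by apply: sub_generated; left. Qed.
Lemma Hgrp_bmx : H b. Proof. by apply: sub_generated; right. Qed.

Lemma thin_SLn : odd N.+1 -> thin_subgroup H (SLn K N).
Proof.
move=> N_even; have HZ : H `<=` integer_points (SLn K N).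
  apply: Hgrp_integer_points; first exact: SLn_is_subgroup.
    exact: det_amx.
  by rewrite /SLn /= det_delta_unipotent // max_neq0.
split=> //; first exact: Hgrp_is_subgroup.
  apply: (zariski_dense_SLn Hgrp_is_subgroup ping_t_neq0 ping_s_neq0
           Hgrp_amx Hgrp_bmx) => //.
  by move=> g /HZ [].
apply: infinite_index_Hgrp => l.
by rewrite /SLn /= det_delta_unipotent // ord0_neq_max.
Qed.

Lemma thin_Spn : ~~ odd N.+1 -> thin_subgroup H (Spn K N).
Proof.
rewrite /= negbK => N_odd; have HZ : H `<=` integer_points (Spn K N).
  apply: Hgrp_integer_points; first exact: Spn_is_subgroup.
    exact: amx_sp.
  by rewrite /bmx /ymx -(rev_ord_max N); apply: corner_sp.
split=> //; first exact: Hgrp_is_subgroup.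
  apply: (zariski_dense_Spn Hgrp_is_subgroup ping_t_neq0 ping_s_neq0
           Hgrp_amx Hgrp_bmx) => //.
  by move=> g /HZ [].
apply: infinite_index_Hgrp => l.
by rewrite /corner -(rev_ord0 N); apply: corner_sp.
Qed.

End Thin.

Theorem corollary3p12 (R : realType) (N : nat) (hN : (2 < N.+1)%N) (t0 : R)
  (ht0 : forall (z : R[i]) (k : int), (t0%:C)%C < `|z| -> k != 0 ->
     [set amx N z ^ k *m v | v in X2 R[i] N] `<=` X1 R[i] N)
  (t s : int) (t_fact : exists k : int, t = (N.+1.-1)`!%:Z * k)
  (ht : t0 < `|t|%:~R) (hs : 2 < `|s|) :
  (odd N.+1 -> thin_subgroup (Hgrp N t%:~R s%:~R) (SLn R[i] N)) /\
  (~~ odd N.+1 -> thin_subgroup (Hgrp N t%:~R s%:~R) (Spn R[i] N)).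
Proof.
have [k tE] := t_fact.
have ping (l : int) v : l != 0 -> X2 R[i] N v -> X1 R[i] N (amx N t%:~R ^ l *m v).
  move=> l0 Xv; apply: (ht0 t%:~R l _ l0); last by exists v.
  (* The modulus of t as a complex number is the integer |t|, so the real bound carries over. *)
  by rewrite -intr_norm -(rmorph_int (real_complex R)) ltcR.
split; [exact: thin_SLn tE hs ping | exact: thin_Spn tE hs ping].
Qed.
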